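(* Let $L/K$ be a finite Galois extension of fields whose Galois group $(G,\circ)$ is the internal semidirect product of a normal subgroup $(A,\circ)$ and a subgroup $(B,\circ)$. Then there is a bijection between (1) skew braces $G=(G,\cdot,\circ)$ (that is, binary operations $\cdot$ on the set $G$ making $(G,\cdot,\circ)$ a skew brace, where $\circ$ is the given operation and distinct operations $\cdot$ count as distinct skew braces) that are the internal semidirect product of an ideal $A$ and a left ideal $B$, where $A$ and $B$ are the given subgroups; (2) Hopf-Galois structures on $L/K$ that realise $L^{A}$ via a normal Hopf subalgebra and $L^{B}$ via a Hopf subalgebra.
   Context: Skew braces. A (left) skew brace is a triple $(G,\cdot,\circ)$ in which $(G,\cdot)$ and $(G,\circ)$ are groups and $x \circ (y \cdot z) = (x \circ y) \cdot x^{-1} \cdot (x \circ z)$ for all $x,y,z \in G$, where $x^{-1}$ is the inverse with respect to $\cdot$. Both groups have the same identity $e$. The $\gamma$-function is the homomorphism $\gamma : (G,\circ) \to \mathrm{Aut}(G,\cdot)$, $\gamma_x(y) = x^{-1}\cdot(x \circ y)$. A left ideal is a subset $A$ that is a subgroup with respect to either operation and satisfies $\gamma_x(A)=A$ for all $x\in G$ (it is then a subgroup for both operations). An ideal is a left ideal $A$ with $(A,\cdot)\trianglelefteq (G,\cdot)$ and $(A,\circ)\trianglelefteq(G,\circ)$. $G$ is the internal semidirect product of an ideal $A$ and a left ideal $B$ if $A \cap B = \{e\}$, $A \cdot B = G$ and $A \circ B = G$. Hopf-Galois structures. A $K$-Hopf algebra $H$ gives a Hopf-Galois structure on a finite extension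 $L/K$ if $L$ is an $H$-module algebra and the natural $K$-linear map $L \otimes_K H \to \mathrm{End}_K(L)$, $x\otimes h \mapsto (y \mapsto x\,h(y))$, is an isomorphism. Hopf-Galois structures given by $H$ and $H'$ are identified if there is an isomorphism of $K$-Hopf algebras $H\to H'$ compatible with the actions on $L$. For a Hopf subalgebra $H'$ of $H$, $L^{H'} = \{x\in L \mid h(x)=\varepsilon(h)x \text{ for all } h \in H'\}$ where $\varepsilon$ is the counit. An intermediate field $L'$ is realised via the Hopf subalgebra $H'$ if $L'=L^{H'}$. A Hopf subalgebra $H'$ is normal if it is stable under the left and right adjoint actions of $H$, i.e. $\sum h_{(1)} k S(h_{(2)}) \in H'$ and $\sum S(h_{(1)}) k h_{(2)} \in H'$ for all $h\in H$, $k \in H'$. For a subgroup $(C,\circ)$ of $(G,\circ)$, $L^C$ denotes the usual fixed field of $C$. *)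

(* Defs.v *)
From HB Require Import structures.
From mathcomp Require Import all_boot all_order all_algebra all_fingroup.
From mathcomp Require Import all_solvable all_field.

Set Implicit Arguments.
Unset Strict Implicit.
Unset Printing Implicit Defensive.

Import GRing.Theory.
Local Open Scope ring_scope.

(* Two group structures live on the same set, so group laws are explicit data
   here rather than canonical structures. *)
Record group_law (G : Type) := GroupLaw {
  gop : G -> G -> G;
  gid : G;
  ginv : G -> G;
  gopA : associative gop;
  gop1g : left_id gid gop;
  gopg1 : right_id gid gop;
  gopVg : left_inverse gid ginv gop;
  gopgV : right_inverse gid ginv gop }.

Definition subgroup_for (G : finType) (m : group_law G) (A : {set G}) : Prop :=
  [/\ gid m \in A,
      {in A &, forall x y, gop m x y \in A}
    & {in A, forall x, ginv m x \in A}].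

Definition normal_subgroup_for (G : finType) (m : group_law G) (A : {set G}) :
  Prop :=
  subgroup_for m A /\
  forall g, {in A, forall a, gop m (gop m g a) (ginv m g) \in A}.

Record skew_brace (G : Type) := SkewBrace {
  dot : group_law G;
  circ : group_law G;
  braceP : forall x y z,
    gop circ x (gop dot y z) =
    gop dot (gop dot (gop circ x y) (ginv dot x)) (gop circ x z) }.

Section SkewBraces.
Variables (G : finType) (S : skew_brace G).

Definition gamma (x y : G) : G :=
  gop (dot S) (ginv (dot S) x) (gop (circ S) x y).

Definition left_ideal (A : {set G}) : Prop :=
  (subgroup_for (dot S) A \/ subgroup_for (circ S) A) /\
  forall x, gamma x @: A = A.

Definition ideal (A : {set G}) : Prop :=
  [/\ left_ideal A,
      normal_subgroup_for (dot S) A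
    & normal_subgroup_for (circ S) A].

Definition internal_semidirect (A B : {set G}) : Prop :=
  [/\ ideal A,
      left_ideal B,
      A :&: B = [set gid (dot S)],
      [set gop (dot S) a b | a in A, b in B] = [set: G]
    & [set gop (circ S) a b | a in A, b in B] = [set: G]].

End SkewBraces.

(* U (x) V is the space of coefficient matrices with respect to the pure tensors
   of basis vectors of U and V. *)
Notation tens U V :=
  'M[_]_(\dim (fullv : {vspace U}), \dim (fullv : {vspace V})).

Section Tensor.
Variables (K : fieldType) (U V : vectType K).

Definition pure (u : U) (v : V) : tens U V :=
  \matrix_(i, j) (coord (vbasis {:U}) i u * coord (vbasis {:V}) j v).

(* The linear map U (x) V -> W induced by a bilinear map f : U -> V -> W. For t
   written \sum t_(1) (x) t_(2) in Sweedler's notation, it is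
   \sum f t_(1) t_(2); see tens_lift_pure. *)
Definition tens_lift (W : lmodType K) (f : U -> V -> W) (t : tens U V) : W :=
  \sum_i \sum_j t i j *: f (vbasis {:U})`_i (vbasis {:V})`_j.

Lemma tens_lift_pure (W : lmodType K) (f : U -> V -> W) :
  (forall u, linear (f u)) -> (forall v, linear (f ^~ v)) ->
  forall u v, tens_lift f (pure u v) = f u v.
Proof.
move=> fr fl u v.
pose gr u := GRing.isLinear.Build K V W *:%R (f u) (fr u).
pose Fr u : {linear V -> W} := HB.pack (f u) (gr u).
pose gl v := GRing.isLinear.Build K U W *:%R (f ^~ v) (fl v).
pose Fl v : {linear U -> W} := HB.pack (f ^~ v) (gl v).
rewrite [in RHS](coord_vbasis (memvf u)) [in RHS](coord_vbasis (memvf v)).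
rewrite -[RHS]/(Fl _ _) linear_sum; apply: eq_bigr => i _.
rewrite linearZ /= -[f _ _]/(Fr _ _) linear_sum scaler_sumr.
by apply: eq_bigr => j _; rewrite linearZ /= mxE scalerA.
Qed.

(* The image of U' (x) V' in U (x) V. *)
Definition tens_sub (U' : {vspace U}) (V' : {vspace V}) : {vspace tens U V} :=
  <<[seq pure u v | u <- vbasis U', v <- vbasis V']>>%VS.

End Tensor.

Definition tens_mul (K : fieldType) (H : falgType K) (s t : tens H H) :
  tens H H :=
  tens_lift (fun a b => tens_lift (fun c d => pure (a * c) (b * d)) t) s.

Record hopf_algebra (K : fieldType) := HopfAlgebra {
  hopf_alg :> falgType K;
  comul : {linear hopf_alg -> tens hopf_alg hopf_alg};
  counit : {linear hopf_alg -> K^o};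
  antipode : {linear hopf_alg -> hopf_alg};
  comulA : forall h,
    tens_lift (fun a b => tens_lift (fun a1 a2 => pure a1 (pure a2 b)) (comul a))
      (comul h) =
    tens_lift (fun a b => pure a (comul b)) (comul h);
  counitl : forall h, tens_lift (fun a b => counit a *: b) (comul h) = h;
  counitr : forall h, tens_lift (fun a b => counit b *: a) (comul h) = h;
  comul1 : comul 1 = pure 1 1;
  comulM : forall h k, comul (h * k) = tens_mul (comul h) (comul k);
  counit1 : counit 1 = 1;
  counitM : forall h k, counit (h * k) = counit h * counit k;
  antipodel : forall h,
    tens_lift (fun a b => antipode a * b) (comul h) = (counit h)%:A;
  antipoder : forall h,
    tens_lift (fun a b => a * antipode b) (comul h) = (counit h)%:A }.

Section HopfSubalgebras.
Variables (K : fieldType) (H : hopf_algebra K).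

Definition hopf_subalgebra (H' : {vspace H}) : Prop :=
  [/\ 1 \in H',
      {in H' &, forall h k, h * k \in H'},
      {in H', forall h, comul H h \in tens_sub H' H'}
    & {in H', forall h, antipode H h \in H'}].

Definition normal_hopf_subalgebra (H' : {vspace H}) : Prop :=
  hopf_subalgebra H' /\
  forall h, {in H', forall k,
    tens_lift (fun a b => a * k * antipode H b) (comul H h) \in H' /\
    tens_lift (fun a b => antipode H a * k * b) (comul H h) \in H'}.

End HopfSubalgebras.

(* Finite-dimensionality of H (hopf_algebra is built on falgType) is no
   restriction: bijectivity of hg_map below forces \dim H = [L : K]. *)
Section HopfGalois.
Variables (K : fieldType) (L : fieldExtType K).

Definition hg_map (H : hopf_algebra K) (act : H -> 'End(L)) :
  tens L H -> 'End(L) :=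
  tens_lift (fun x h => (amull x \o act h)%VF).

Record hopf_galois := HopfGalois {
  hg_alg :> hopf_algebra K;
  hg_act : {linear hg_alg -> 'End(L)};
  hg_act1 : forall x, hg_act 1 x = x;
  hg_actM : forall h k x, hg_act (h * k) x = hg_act h (hg_act k x);
  hg_act_one : forall h, hg_act h 1 = (counit hg_alg h)%:A;
  hg_act_mul : forall h x y,
    hg_act h (x * y) =
    tens_lift (fun a b => hg_act a x * hg_act b y) (comul hg_alg h);
  hg_bij : bijective (hg_map hg_act) }.

Definition hg_iso (S T : hopf_galois) : Prop :=
  exists f : {lrmorphism S -> T},
    [/\ bijective f,
        forall h, comul T (f h) =
                  tens_lift (fun a b => pure (f a) (f b)) (comul S h),
        forall h, counit T (f h) = counit S h,
        forall h, antipode T (f h) = f (antipode S h)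
      & forall h x, hg_act T (f h) x = hg_act S h x].

Definition realises_via (S : hopf_galois) (H' : {vspace S}) (L' : {vspace L}) :
  Prop :=
  forall x, x \in L' <-> {in H', forall h, hg_act S h x = counit S h *: x}.

End HopfGalois.

Section Correspondence.
Variables (K : fieldType) (L : splittingFieldType K).

(* The multiplication of gal_of composes from left to right; the Galois group
   law here is ordinary composition of maps, see gal_compE. The two laws have
   the same subgroups, normal subgroups and semidirect decompositions. *)
Definition gal_comp (x y : gal_of {:L}) : gal_of {:L} := (y * x)%g.

Lemma gal_compE x y a : gal_comp x y a = x (y a).
Proof. by rewrite /gal_comp galM ?memvf. Qed.

Variables A B : {set gal_of {:L}}.

Definition is_semidirect_brace_op (op : gal_of {:L} -> gal_of {:L} -> gal_of {:L})
  : Prop :=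
  exists S : skew_brace (gal_of {:L}),
    [/\ gop (dot S) =2 op, gop (circ S) =2 gal_comp & internal_semidirect S A B].

Definition semidirect_brace_op : Type := {op | is_semidirect_brace_op op}.

Definition realises_semidirect (S : hopf_galois L) : Prop :=
  (exists H' : {vspace S},
     normal_hopf_subalgebra H' /\ realises_via H' (fixedField A)) /\
  (exists H' : {vspace S},
     hopf_subalgebra H' /\ realises_via H' (fixedField B)).

(* Isomorphism classes of Hopf-Galois structures, as predicates. *)
Definition hopf_galois_class : Type :=
  {C : hopf_galois L -> Prop |
     exists S, realises_semidirect S /\ C = hg_iso S}.

End Correspondence.

(* Main.v *)
Require Import Defs.
From mathcomp Require Import all_boot all_order all_algebra all_fingroup.
From mathcomp Require Import all_solvable all_field.
From Stdlib Require Import FunctionalExtensionality PropExtensionality.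
From Stdlib Require Import ProofIrrelevance IndefiniteDescription.
From HB Require Import structures.

(* By Dedekind independence every K-endomorphism of L is uniquely
   \sum_x c_x x with c_x in L and x in the Galois group G, so a Hopf-Galois
   structure T gives functionals c_x : T -> L. Bijectivity of L (x) T -> End(L)
   makes them an L-basis of Hom(T, L), and the module-algebra axiom says that
   they are the orthogonal idempotents of that algebra:
   c_x(h_1) c_y(h_2) = [x = y] c_x(h). An automorphism g of L permutes these
   idempotents, g o c_x = c_(gamma_g x), and this gamma is the gamma-function
   of a skew brace (G, ., o) for which
   c_z(h k) = \sum_(x . y = z) c_x(h) c_y(k).
   Conversely gamma recovers T as the endomorphisms whose coefficients satisfy
   c_(gamma_g x) = g(c_x); Galois descent turns the Hopf algebra L[(G, .)] into
   a Hopf algebra structure on them. A Hopf subalgebra is detected by the set C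
   of all x for which c_x does not vanish on it: its L-span is then L^C, so C is
   a left ideal, the realised field is the fixed field of C, and normality of
   the Hopf subalgebra is normality of C in (G, .). *)

Set Implicit Arguments.
Unset Strict Implicit.
Unset Printing Implicit Defensive.

Import GRing.Theory.
Local Open Scope ring_scope.

(** * Tensors and points *)

Lemma sum_delta (R : pzRingType) (I : finType) (F : I -> R) k :
  \sum_i (i == k)%:R * F i = F k.
Proof.
rewrite (bigD1 k) //= eqxx mul1r big1 ?addr0 // => i /negPf ->.
by rewrite mul0r.
Qed.

Section TensLift.
Variables (K : fieldType) (U V : vectType K).

Fact tens_lift_is_linear (W : lmodType K) (f : U -> V -> W) :
  linear (tens_lift f).
Proof.
move=> a s t; rewrite /tens_lift scaler_sumr -big_split; apply: eq_bigr => i _.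
rewrite /= scaler_sumr -big_split; apply: eq_bigr => j _.
by rewrite !mxE scalerDl scalerA.
Qed.
HB.instance Definition _ (W : lmodType K) (f : U -> V -> W) :=
  GRing.isLinear.Build K (tens U V) W *:%R (tens_lift f)
    (@tens_lift_is_linear W f).

Lemma eq_tens_lift (W : lmodType K) (f g : U -> V -> W) t :
  (forall u v, f u v = g u v) -> tens_lift f t = tens_lift g t.
Proof. by move=> fg; do 2!apply: eq_bigr => ? _; rewrite fg. Qed.

Lemma linear_tens_lift (W W' : lmodType K) (phi : {linear W -> W'})
    (f : U -> V -> W) t :
  phi (tens_lift f t) = tens_lift (fun u v => phi (f u v)) t.
Proof.
rewrite linear_sum; apply: eq_bigr => i _; rewrite linear_sum.
by apply: eq_bigr => j _; rewrite linearZ.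
Qed.

Lemma tens_lift_suml (W : lmodType K) (I : finType) (f : I -> U -> V -> W) t :
  tens_lift (fun u v => \sum_i f i u v) t = \sum_i tens_lift (f i) t.
Proof.
rewrite exchange_big; apply: eq_bigr => i _; rewrite exchange_big.
by apply: eq_bigr => j _; rewrite scaler_sumr.
Qed.

Lemma tens_liftMl (W : algType K) (x : W) (f : U -> V -> W) t :
  x * tens_lift f t = tens_lift (fun u v => x * f u v) t.
Proof.
rewrite mulr_sumr; apply: eq_bigr => i _; rewrite mulr_sumr.
by apply: eq_bigr => j _; rewrite scalerAr.
Qed.

Lemma tens_liftMr (W : algType K) (x : W) (f : U -> V -> W) t :
  tens_lift f t * x = tens_lift (fun u v => f u v * x) t.
Proof.
rewrite mulr_suml; apply: eq_bigr => i _; rewrite mulr_suml.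
by apply: eq_bigr => j _; rewrite scalerAl.
Qed.

Lemma pureDl (v : V) : linear (fun u : U => pure u v).
Proof.
by move=> a u u'; apply/matrixP=> i j; rewrite !mxE linearP mulrDl /= mulrA.
Qed.

Lemma pureDr (u : U) : linear (fun v : V => pure u v).
Proof.
by move=> a v v'; apply/matrixP=> i j; rewrite !mxE linearP mulrDr /= mulrCA.
Qed.

Lemma tens_lift_sub (W : lmodType K) (f : U -> V -> W)
    (U' : {vspace U}) (V' : {vspace V}) t :
  (forall u, linear (f u)) -> (forall v, linear (f ^~ v)) ->
  {in U' & V', forall u v, f u v = 0} -> t \in tens_sub U' V' ->
  tens_lift f t = 0.
Proof.
move=> fr fl f0 tUV.
rewrite (@coord_span _ _ _
  (in_tuple [seq pure u v | u <- vbasis U', v <- vbasis V']) t tUV).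
rewrite linear_sum big1 // => i _; rewrite linearZ /=.
have /allpairsP[[u v] [/= uU vV ->]] :
  [seq pure u v | u <- vbasis U', v <- vbasis V']`_i \in
    [seq pure u v | u <- vbasis U', v <- vbasis V'] by rewrite mem_nth.
by rewrite tens_lift_pure // f0 ?scaler0 ?vbasis_mem.
Qed.

Lemma pure_tens_sub (U' : {vspace U}) (V' : {vspace V}) u v :
  u \in U' -> v \in V' -> pure u v \in tens_sub U' V'.
Proof.
move=> uU vV; rewrite (coord_vbasis uU) (coord_vbasis vV).
pose Fr u : {linear V -> tens U V} := HB.pack (fun v : V => pure u v)
  (GRing.isLinear.Build K V (tens U V) *:%R _ (pureDr u)).
pose Fl v : {linear U -> tens U V} := HB.pack (fun u : U => pure u v)
  (GRing.isLinear.Build K U (tens U V) *:%R _ (pureDl v)).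
rewrite -[pure _ _]/(Fl _ _) linear_sum memv_suml // => i _.
rewrite linearZ /= memvZ // -[pure _ _]/(Fr _ _) linear_sum memv_suml // => j _.
rewrite linearZ memvZ //=; apply/memv_span/allpairsP.
exists ((vbasis U')`_i, (vbasis V')`_j).
by split=> //=; rewrite mem_nth ?size_tuple.
Qed.

Lemma tens_lift_id (t : tens U V) : tens_lift (@pure K U V) t = t.
Proof.
apply/matrixP=> k l; rewrite summxE (bigD1 k) //= summxE (bigD1 l) //=.
have cb (W : vectType K) (i j : 'I_(\dim {:W})) :
    coord (vbasis {:W}) i (vbasis {:W})`_j = (i == j)%:R.
  by rewrite coord_free ?(basis_free (vbasisP _)) // eq_sym.
rewrite !mxE !cb !eqxx !mulr1 big1 ?addr0 => [|j /negPf jl]; last first.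
  by rewrite !mxE !cb [l == j]eq_sym jl !mulr0.
rewrite big1 ?addr0 // => i /negPf ik; rewrite summxE big1 // => j _.
by rewrite !mxE !cb [k == i]eq_sym ik mul0r mulr0.
Qed.

Definition slice (t : tens U V) i : V := \sum_j t i j *: (vbasis {:V})`_j.

Lemma sum_slice (t : tens U V) :
  t = \sum_(i < \dim {:U}) pure (vbasis {:U})`_i (slice t i).
Proof.
rewrite -[LHS]tens_lift_id; apply: eq_bigr => i _.
pose F : {linear V -> tens U V} :=
  HB.pack (fun v : V => pure (vbasis {:U})`_i v)
    (GRing.isLinear.Build K V (tens U V) *:%R _ (pureDr _)).
rewrite -[pure _ (slice t i)]/(F _) linear_sum; apply: eq_bigr => j _.
by rewrite linearZ.
Qed.

End TensLift.

Section Points.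
Variables (K : fieldType) (L : fieldExtType K).

(* For U' = U and P = I, [detects] says that the c i are linearly independent
   over L as functionals on U. *)
Definition detects (U : vectType K) (I : finType) (c : I -> 'Hom(U, L))
    (U' : {vspace U}) (P : {set I}) :=
  forall a : I -> L, {in U', forall u, \sum_i a i * c i u = 0} ->
  {in P, forall i, a i = 0}.

(* Injectivity of the L-linear extension of c to L (x) U. *)
Definition separates (U : vectType K) (I : finType) (c : I -> 'Hom(U, L)) :=
  forall a : 'I_(\dim {:U}) -> L,
  (forall i, \sum_j a j * c i (vbasis {:U})`_j = 0) -> forall j, a j = 0.

Lemma vbasis_eq0 (U : vectType K) (a : 'I_(\dim {:U}) -> K) :
  \sum_j a j *: (vbasis {:U})`_j = 0 -> forall j, a j = 0.
Proof. exact/freeP/(basis_free (vbasisP _)). Qed.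

(** The coordinates of [u], embedded in [L], form a relation of the kind that [separates] excludes.
    For a family permuted by the Galois group the converse is [trace_separates]. *)
Lemma separates_eq0 (U : vectType K) (I : finType) (c : I -> 'Hom(U, L)) u :
  separates c -> (forall i, c i u = 0) -> u = 0.
Proof.
move=> sepc cu0; rewrite (coord_vbasis (memvf u)) big1 // => j _.
suff /eqP: in_alg L (coord (vbasis {:U}) j u) = 0.
  by rewrite fmorph_eq0 => /eqP ->; rewrite scale0r.
rewrite [LHS]/=.
apply: (sepc (fun j => (coord (vbasis {:U}) j u)%:A)) => i.
rewrite -[RHS](cu0 i) [u in RHS](coord_vbasis (memvf u)) linear_sum.
by apply: eq_bigr => k _; rewrite linearZ mulr_algl.
Qed.

Lemma separates_inj (U : vectType K) (I : finType) (c : I -> 'Hom(U, L)) u v :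
  separates c -> (forall i, c i u = c i v) -> u = v.
Proof.
move=> sepc cuv; apply/eqP; rewrite -subr_eq0; apply/eqP.
by apply: separates_eq0 sepc _ => i; rewrite linearB /= cuv subrr.
Qed.

Lemma detects_vbasis (U : vectType K) (I : finType) (c : I -> 'Hom(U, L)) a :
  (forall j : 'I_(\dim {:U}), \sum_i a i * c i (vbasis {:U})`_j = 0) ->
  forall u, \sum_i a i * c i u = 0.
Proof.
move=> a0 u; rewrite (coord_vbasis (memvf u)).
under eq_bigr do rewrite linear_sum mulr_sumr.
rewrite exchange_big big1 // => j _ /=.
by under eq_bigr do rewrite linearZ -scalerAr; rewrite -scaler_sumr a0 scaler0.
Qed.

(** By [detects] the rows of the matrix of values of [c] on the basis of [U] are independent over
    [L], so its columns span all of L^I. *)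
Lemma detects_solve (U : vectType K) (I : finType) (c : I -> 'Hom(U, L))
    (v : I -> L) :
  detects c {:U} [set: I] ->
  exists a : 'I_(\dim {:U}) -> L,
    forall i, \sum_j a j * c i (vbasis {:U})`_j = v i.
Proof.
move=> detc.
pose M : 'M[L]_(#|I|, \dim {:U}) :=
  \matrix_(i, j) c (enum_val i) (vbasis {:U})`_j.
have freeM : row_free M.
  apply: inj_row_free => w wM0; apply/rowP => i; rewrite mxE -[i]enum_valK.
  apply: (detc (fun k => w 0 (enum_rank k))) => // u _.
  apply: detects_vbasis => {u} j; have /rowP/(_ j) := wM0.
  rewrite mxE [RHS]mxE => wM0j; rewrite -[RHS]wM0j.
  rewrite (reindex (fun k : 'I_#|I| => enum_val k)).
    by apply: eq_bigr => k _; rewrite mxE enum_valK.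
  by apply: onW_bij; apply: enum_val_bij.
have /submxP[a Ea] : (\row_i v (enum_val i) <= M^T)%MS.
  by apply: submx_full; rewrite /row_full mxrank_tr.
exists (fun j => a 0 j) => i; have /rowP/(_ (enum_rank i)) := Ea.
rewrite !mxE enum_rankK => ->; apply: eq_bigr => j _.
by rewrite !mxE enum_rankK.
Qed.

Section Eval.
Variables (U V : vectType K) (I J : finType).
Variables (c : I -> 'Hom(U, L)) (d : J -> 'Hom(V, L)).

Definition ev i j : tens U V -> L := tens_lift (fun u v => c i u * d j v).
HB.instance Definition _ i j := GRing.Linear.on (ev i j).

Lemma mulr_linearr i (j : J) u : linear (fun v => c i u * d j v).
Proof. by move=> a v w; rewrite linearP mulrDr scalerAr. Qed.

Lemma mulr_linearl (i : I) j v : linear (fun u => c i u * d j v).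
Proof. by move=> a u w; rewrite linearP mulrDl scalerAl. Qed.

Lemma ev_pure i j u v : ev i j (pure u v) = c i u * d j v.
Proof.
by rewrite /ev tens_lift_pure // => w; [apply: mulr_linearr|apply: mulr_linearl].
Qed.

Lemma ev_slice i j t :
  ev i j t = \sum_(k < \dim {:U}) d j (slice t k) * c i (vbasis {:U})`_k.
Proof.
apply: eq_bigr => k _; rewrite linear_sum mulr_suml; apply: eq_bigr => l _.
by rewrite linearZ mulrC scalerAl.
Qed.

Lemma ev_slice_eq0 j t : separates c -> (forall i, ev i j t = 0) ->
  forall k, d j (slice t k) = 0.
Proof. by move=> sepc t0; apply: sepc => i; rewrite -ev_slice t0. Qed.

(** Only the first family has to separate over [L]: slicing leaves vectors of [V], for which joint
    injectivity is enough. This lets the second factor be a tensor product itself, as in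
    [inv_comulA]. *)
Lemma ev_inj s t : separates c -> (forall v, (forall j, d j v = 0) -> v = 0) ->
  (forall i j, ev i j s = ev i j t) -> s = t.
Proof.
move=> sepc sepd st; apply/eqP; rewrite -subr_eq0; apply/eqP.
apply/matrixP=> k l; rewrite [RHS]mxE; move: l; apply: vbasis_eq0.
by apply: sepd => j; apply: ev_slice_eq0 => // i; rewrite linearB /= st subrr.
Qed.

End Eval.
End Points.

(** * Skew braces and coefficients of endomorphisms *)

Section GroupLaw.
Variables (G : Type) (m : group_law G).

Lemma gopK x y : gop m (ginv m x) (gop m x y) = y.
Proof. by rewrite gopA gopVg gop1g. Qed.

Lemma gopVK x y : gop m x (gop m (ginv m x) y) = y.
Proof. by rewrite gopA gopgV gop1g. Qed.

Lemma gopI x : injective (gop m x).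
Proof. by move=> y z /(congr1 (gop m (ginv m x))); rewrite !gopK. Qed.

Lemma gopIr x : injective (gop m ^~ x).
Proof.
move=> y z /(congr1 (fun t => gop m t (ginv m x))) /=.
by rewrite -!gopA gopgV !gopg1.
Qed.

Lemma ginv_eq x y : gop m x y = gid m -> y = ginv m x.
Proof. by move=> xy; apply: (@gopI x); rewrite xy gopgV. Qed.

Lemma ginvK : involutive (ginv m).
Proof. by move=> x; apply/esym/ginv_eq; rewrite gopVg. Qed.

Lemma ginvM x y : ginv m (gop m x y) = gop m (ginv m y) (ginv m x).
Proof. by apply/esym/ginv_eq; rewrite -gopA gopVK gopgV. Qed.

Lemma ginv1 : ginv m (gid m) = gid m.
Proof. by apply/esym/ginv_eq; rewrite gop1g. Qed.

End GroupLaw.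

Section SkewBraceTheory.
Variables (G : finType) (S : skew_brace G).

Lemma gid_circ : gid (circ S) = gid (dot S).
Proof.
have := braceP S (gid (circ S)) (gid (dot S)) (gid (dot S)).
rewrite !gop1g gopg1 => /(congr1 (ginv (dot S))).
by rewrite ginvK ginv1.
Qed.

Lemma circE x y : gop (circ S) x y = gop (dot S) x (gamma S x y).
Proof. by rewrite /gamma gopVK. Qed.

Lemma gammaD x y z :
  gamma S x (gop (dot S) y z) = gop (dot S) (gamma S x y) (gamma S x z).
Proof. by rewrite /gamma braceP !gopA. Qed.

Lemma gamma1 x : gamma S x (gid (dot S)) = gid (dot S).
Proof. by rewrite /gamma -gid_circ gopg1 gid_circ gopVg. Qed.

Lemma gammaV x y : gamma S x (ginv (dot S) y) = ginv (dot S) (gamma S x y).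
Proof. by apply: ginv_eq; rewrite -gammaD gopgV gamma1. Qed.

Lemma gamma_id y : gamma S (gid (circ S)) y = y.
Proof. by rewrite /gamma gop1g gid_circ ginv1 gop1g. Qed.

Lemma gamma_circ x y z :
  gamma S (gop (circ S) x y) z = gamma S x (gamma S y z).
Proof.
rewrite {3}/gamma gammaD gammaV {2 3}/gamma ginvM ginvK -!gopA gopVK.
by rewrite /gamma !gopA.
Qed.

Lemma gammaK x : cancel (gamma S x) (gamma S (ginv (circ S) x)).
Proof. by move=> y; rewrite -gamma_circ gopVg gamma_id. Qed.

Lemma gammaVK x : cancel (gamma S (ginv (circ S) x)) (gamma S x).
Proof. by move=> y; rewrite -gamma_circ gopgV gamma_id. Qed.

End SkewBraceTheory.

Section Coefficients.
Variables (K : fieldType) (L : splittingFieldType K).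
Hypothesis galL : galois 1%VS {:L}.
Local Notation G := (gal_of {:L}).

Lemma Gal1f : 'Gal({:L} / 1)%g = [set: G].
Proof.
apply/setP=> x; by rewrite inE gal_kAut ?sub1v // kAut1E subvf.
Qed.

Lemma card_gal_of : #|{: G}| = \dim {:L}.
Proof.
by rewrite -cardsT -Gal1f -(galois_dim galL) dimv1 divn1.
Qed.

Lemma gal_detects : detects (fun x : G => gal_repr x : 'Hom(L, L)) {:L} setT.
Proof.
move=> a a0 x _; apply: (@gal_independent _ _ _ predT) => //.
Qed.

Lemma gal_fixed_scalar (a : L) :
  (forall x : G, x a = a) -> exists k : K, a = k%:A.
Proof.
move=> fixa; apply/vlineP; rewrite -(galois_fixedField galL).
by apply/fixedFieldP; rewrite ?memvf.
Qed.

Definition sum_gal (u : {ffun G -> L}) : 'End(L) :=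
  \sum_x (amull (u x) \o gal_repr x)%VF.

Lemma sum_galE u a : sum_gal u a = \sum_x u x * x a.
Proof.
by rewrite sum_lfunE; apply: eq_bigr => x _; rewrite comp_lfunE lfunE.
Qed.

Fact sum_gal_is_linear : linear sum_gal.
Proof.
move=> k u v; apply/lfunP => a; rewrite add_lfunE scale_lfunE !sum_galE.
rewrite scaler_sumr -big_split; apply: eq_bigr => x _ /=.
by rewrite !ffunE mulrDl scalerAl.
Qed.
HB.instance Definition _ :=
  GRing.isLinear.Build K {ffun G -> L} 'End(L) *:%R sum_gal sum_gal_is_linear.

(** The coefficient of [x] in the expansion of [f] over the Galois group. The inverse taken here is
    a priori a pseudo-inverse; [sum_gal_inj] and the dimension count in [cfK] make it a genuine
    one. *)
Definition cf (x : G) : 'Hom('End(L), L) :=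
  linfun (fun f : 'End(L) => ((linfun sum_gal)^-1)%VF f x).

Lemma cfE x f : cf x f = ((linfun sum_gal)^-1)%VF f x.
Proof.
pose F := (fun f : 'End(L) => ((linfun sum_gal)^-1)%VF f x).
have linF : linear F by move=> k g h; rewrite /F linearP !ffunE.
pose Fl : {linear 'End(L) -> L} := HB.pack F (GRing.isLinear.Build _ _ _ _ F linF).
exact: (lfunE Fl).
Qed.

Lemma sum_gal_inj : injective sum_gal.
Proof.
move=> u v uv; apply/ffunP => x; apply/eqP; rewrite -subr_eq0; apply/eqP.
apply: (gal_detects (a := fun x => u x - v x)) => // a _.
under eq_bigr do rewrite mulrBl; rewrite sumrB -!sum_galE uv; exact: subrr.
Qed.

Lemma cf_sum_gal u x : cf x (sum_gal u) = u x.
Proof.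
rewrite cfE -[sum_gal u]lfunE lker0_lfunK //.
by apply/lker0P => v w; rewrite !lfunE; apply: sum_gal_inj.
Qed.

(** [sum_gal] is injective, and its source and target have the same dimension over [K], since |G| =
    [L : K] for a Galois extension; hence it is onto. *)
Lemma cfK (f : 'End(L)) a : f a = \sum_x cf x f * x a.
Proof.
have ker0 : lker (linfun sum_gal) == 0%VS.
  by apply/lker0P => v w; rewrite !lfunE; apply: sum_gal_inj.
have : f \in limg (linfun sum_gal).
  suff -> : limg (linfun sum_gal) = fullv by exact: memvf.
  apply/eqP; rewrite eqEdim subvf /= limg_dim_eq ?(eqP ker0) ?capv0 //.
  by rewrite !dimvf /= /dim /= card_gal_of dimvf.
case/memv_imgP => u _ ->; rewrite lfunE sum_galE.
by apply: eq_bigr => x _; rewrite cf_sum_gal.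
Qed.

Lemma cf_eq (f : 'End(L)) (u : G -> L) :
  (forall a, f a = \sum_x u x * x a) -> forall x, cf x f = u x.
Proof.
move=> fu x; rewrite -[RHS](ffunE u) -cf_sum_gal; congr (cf x _).
by apply/lfunP => a; rewrite fu sum_galE; apply: eq_bigr => y _; rewrite ffunE.
Qed.

Lemma cf_inj (f g : 'End(L)) : (forall x, cf x f = cf x g) -> f = g.
Proof.
by move=> fg; apply/lfunP => a; rewrite !cfK; apply: eq_bigr => x _; rewrite fg.
Qed.

Lemma cf_id x : cf x \1%VF = (x == 1%g)%:R.
Proof.
apply: (cf_eq (u := fun x => (x == 1%g)%:R)) => a.
rewrite (bigD1 1%g) //= eqxx mul1r gal_id id_lfunE.
by rewrite big1 ?addr0 // => y /negPf ->; rewrite mul0r.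
Qed.

(** The product rule of a crossed product: composing c x with d y gives the coefficient c x(d) at
    the composite. As [*] is read from left to right, x after y is [y * x], whence the index
    [z * x^-1]. *)
Lemma cf_comp z (f g : 'End(L)) :
  cf z (f \o g)%VF = \sum_x cf x f * x (cf (z * x^-1)%g g).
Proof.
apply: (cf_eq (u := fun z => \sum_x cf x f * x (cf (z * x^-1)%g g))) => a.
rewrite comp_lfunE [LHS]cfK.
under [RHS]eq_bigr do rewrite mulr_suml.
rewrite exchange_big; apply: eq_bigr => x _ /=.
rewrite [g a]cfK rmorph_sum mulr_sumr (reindex (fun y => y * x^-1)%g) /=.
  apply: eq_bigr => y _; rewrite rmorphM mulrA; congr (_ * _) => /=.
  by rewrite -galM ?memvf // mulgKV.
by exists (fun y => y * x)%g => y _; rewrite ?mulgK ?mulgKV.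
Qed.

End Coefficients.

(** * Points of a Hopf-Galois structure *)

Section HopfGaloisPoints.
Variables (K : fieldType) (L : splittingFieldType K).
Hypothesis galL : galois 1%VS {:L}.
Local Notation G := (gal_of {:L}).

Lemma cf_hg_map (H : hopf_algebra K) (act : H -> 'End(L)) (t : tens L H) x :
  cf x (hg_map act t) = tens_lift (fun l h => l * cf x (act h)) t.
Proof.
apply: (cf_eq (u := fun x => tens_lift (fun l h => l * cf x (act h)) t)) => a.
under [RHS]eq_bigr do rewrite tens_liftMr.
rewrite -tens_lift_suml sum_lfunE; apply: eq_bigr => i _; rewrite sum_lfunE.
apply: eq_bigr => j _; rewrite scale_lfunE comp_lfunE lfunE; congr (_ *: _).
rewrite (cfK galL) [LHS]mulr_sumr; apply: eq_bigr => y _.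
by rewrite mulrA.
Qed.

Variable T : hopf_galois L.

Definition pt (x : G) : 'Hom(T, L) := (cf x \o linfun (hg_act T))%VF.

Lemma ptE x h : pt x h = cf x (hg_act T h).
Proof. by rewrite comp_lfunE lfunE. Qed.

Lemma hg_actE h a : hg_act T h a = \sum_x pt x h * x a.
Proof. by rewrite (cfK galL); apply: eq_bigr => x _; rewrite ptE. Qed.

Lemma cf_hg_map_pt (t : tens L T) x :
  cf x (hg_map (hg_act T) t) = tens_lift (fun l h => l * pt x h) t.
Proof. by rewrite cf_hg_map; apply: eq_tens_lift => l h; rewrite ptE. Qed.

(** This is surjectivity of [hg_map]: an [L]-relation among the points passes to the coefficients
    [cf] on the image of [hg_map], which is all of ['End(L)]. *)
Lemma pt_detects : detects pt {:T} setT.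
Proof.
move=> a a0 y _; have [g _ gK] := hg_bij T.
(* This is the automorphism [y] itself; its only nonzero coefficient isolates [a y]. *)
pose f := sum_gal [ffun x => (x == y)%:R : L].
transitivity (\sum_x a x * cf x f).
  rewrite (bigD1 y) //= cf_sum_gal // ffunE eqxx mulr1 big1 ?addr0 // => x.
  by rewrite cf_sum_gal // ffunE => /negPf ->; rewrite mulr0.
rewrite -[f]gK; under eq_bigr do rewrite cf_hg_map_pt tens_liftMl.
rewrite -tens_lift_suml /tens_lift big1 // => i _; rewrite big1 // => j _.
under eq_bigr do rewrite mulrCA.
by rewrite -mulr_sumr a0 ?memvf // mulr0 scaler0.
Qed.

Lemma pt_inj x y : (forall h, pt x h = pt y h) -> x = y.
Proof.
move=> xy; apply/eqP/contraT => ne; have /eqP := oner_eq0 L; case.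
transitivity ((x == x)%:R - (x == y)%:R : L).
  by rewrite eqxx (negPf ne) subr0.
apply: (pt_detects (a := fun z => (z == x)%:R - (z == y)%:R)) => // h _.
by under eq_bigr do rewrite mulrBl; rewrite sumrB !sum_delta xy subrr.
Qed.

(** This is injectivity of [hg_map]: the tensor [t] with [L]-coordinates [a] along the basis of [T]
    is sent to an endomorphism whose coefficients are the given vanishing sums. *)
Lemma pt_separates : separates pt.
Proof.
move=> a a0.
pose t : tens L T := \matrix_(i, j) coord (vbasis {:L}) i (a j).
have aE j : a j = \sum_i t i j *: (vbasis {:L})`_i.
  rewrite [LHS](coord_vbasis (memvf _)); apply: eq_bigr => i _.
  by rewrite mxE.
suff t0 : t = 0 by move=> j; rewrite aE big1 // => i _; rewrite t0 mxE scale0r.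
apply: (bij_inj (hg_bij T)); apply: (cf_inj galL) => x.
rewrite !cf_hg_map_pt linear0 -[RHS](a0 x) /tens_lift exchange_big.
apply: eq_bigr => j _; rewrite aE mulr_suml; apply: eq_bigr => i _.
by rewrite scalerAl.
Qed.

(** Expand both sides of the module-algebra axiom for h(ab) over pairs of automorphisms. Dedekind
    independence, applied to one variable at a time, then compares coefficients. *)
Lemma ev_comul x y h : ev pt pt x y (comul T h) = (x == y)%:R * pt x h.
Proof.
have E (a b : L) : \sum_(x : G) \sum_(y : G) (ev pt pt x y (comul T h) -
    (x == y)%:R * pt x h) * y b * x a = 0.
  have := hg_act_mul h a b; rewrite hg_actE.
  rewrite (@eq_tens_lift _ _ _ _ _
    (fun u v => \sum_(x : G) \sum_(y : G) x a * y b * (pt x u * pt y v))); last first.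
    move=> u v; rewrite !hg_actE mulr_suml; apply: eq_bigr => z _.
    rewrite mulr_sumr; apply: eq_bigr => w _.
    by rewrite mulrACA mulrC.
  rewrite tens_lift_suml => E; apply/eqP.
  under eq_bigr => z _ do under eq_bigr => w _ do rewrite !mulrBl.
  under eq_bigr do rewrite sumrB.
  rewrite sumrB subr_eq0; apply/eqP.
  transitivity (\sum_x pt x h * x (a * b)).
    rewrite E; apply: eq_bigr => z _; rewrite tens_lift_suml.
    apply: eq_bigr => w _; rewrite -tens_liftMl.
    by rewrite mulrC -/(ev _ _ _ _ _) mulrA mulrAC.
  apply: eq_bigr => z _; rewrite (bigD1 z) //= big1 ?addr0.
    by rewrite eqxx mul1r -mulrA [z b * _]mulrC rmorphM.
  by move=> w /negPf zw; rewrite eq_sym zw !mul0r.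
apply/eqP; rewrite -subr_eq0; apply/eqP.
apply: (gal_detects (a := fun y => ev pt pt x y (comul T h) -
    (x == y)%:R * pt x h)) => // b _.
apply: (gal_detects (a := fun x => \sum_(y : G) (ev pt pt x y (comul T h) -
    (x == y)%:R * pt x h) * y b)) => // a _.
by rewrite -[RHS](E a b); apply: eq_bigr => z _; rewrite mulr_suml.
Qed.

Lemma sum_pt h : \sum_x pt x h = ((counit T h : K)%:A : L).
Proof.
by rewrite -(hg_act_one h) hg_actE; apply: eq_bigr => x _; rewrite rmorph1 mulr1.
Qed.

Lemma pt1 x : pt x 1 = (x == 1%g)%:R.
Proof.
rewrite ptE -(cf_id); congr (cf x _); apply/lfunP => a.
by rewrite hg_act1 id_lfunE.
Qed.

Lemma ptM_circ z h k :
  pt z (h * k) = \sum_x pt x h * x (pt (z * x^-1)%g k).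
Proof.
rewrite ptE (_ : hg_act T (h * k) = hg_act T h \o hg_act T k)%VF.
  by rewrite (cf_comp galL); apply: eq_bigr => x _; rewrite !ptE.
by apply/lfunP => a; rewrite hg_actM comp_lfunE.
Qed.

End HopfGaloisPoints.

(** * Galois descent *)

Lemma tr_pure (K : fieldType) (U V : vectType K) (u : U) (v : V) :
  (pure u v)^T = pure v u.
Proof. by apply/matrixP=> i j; rewrite !mxE mulrC. Qed.

Section TensSub.
Variables (K : fieldType) (U V : vectType K).

(** The intersection of U' (x) V and U (x) V' is U' (x) V': the projection [P] of the first factor
    onto U' fixes [t], and applied to an expansion with second factors in V' it lands in U' (x)
    V'. *)
Lemma mem_tens_sub (U' : {vspace U}) (V' : {vspace V}) (t : tens U V) :
  (forall k, slice t k \in V') -> (forall k, slice t^T k \in U') ->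
  t \in tens_sub U' V'.
Proof.
move=> tV tU.
pose P : {linear tens U V -> tens U V} :=
  tens_lift (fun (u : U) (v : V) => pure (projv U' u) v).
have Ppure u v : P (pure u v) = pure (projv U' u) v.
  rewrite /P /= tens_lift_pure // => w a x y; first exact: pureDr.
  by rewrite linearP pureDl.
have tE : t = \sum_(k < \dim {:V}) pure (slice t^T k) (vbasis {:V})`_k.
  rewrite -{1}[t]trmxK {1}[t^T]sum_slice linear_sum; apply: eq_bigr => k _.
  exact: tr_pure.
have -> : t = P t.
  rewrite tE linear_sum; apply: eq_bigr => k _.
  by rewrite Ppure projv_id.
rewrite [t]sum_slice linear_sum memv_suml //= => k _.
by rewrite Ppure pure_tens_sub // memv_proj.
Qed.

End TensSub.

Section Descent.
Variables (K : fieldType) (L : splittingFieldType K).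
Local Notation G := (gal_of {:L}).

(** The hypotheses say that the matrix of values of [c] on the basis of [U] is invertible over [L].
    The array [d] is a one-sided inverse by construction, and [dual] is the identity on the other
    side. *)
Lemma expand_points (U : vectType K) (I : finType) (c : I -> 'Hom(U, L))
    (s : 'Hom(U, L)) :
  detects c {:U} setT -> separates c ->
  exists p : I -> L, forall u, s u = \sum_i p i * c i u.
Proof.
move=> detc sepc.
have /fin_all_exists[d dE] i := detects_solve (fun j => (j == i)%:R : L) detc.
exists (fun i => \sum_j d i j * s (vbasis {:U})`_j) => u.
have dual (k j : 'I_(\dim {:U})) :
    \sum_i d i j * c i (vbasis {:U})`_k = (j == k)%:R.
  apply/eqP; rewrite -subr_eq0; apply/eqP; move: j; apply: sepc => i.
  under eq_bigr do rewrite mulrBl; rewrite sumrB.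
  rewrite (sum_delta (fun j => c i (vbasis {:U})`_(j : 'I_(\dim {:U})))).
  under eq_bigr do rewrite mulr_suml; rewrite exchange_big /=.
  apply/eqP; rewrite subr_eq0; apply/eqP.
  under eq_bigr do under eq_bigr do rewrite mulrAC.
  under eq_bigr do rewrite -mulr_suml dE eq_sym.
  by rewrite sum_delta.
rewrite [in LHS](coord_vbasis (memvf u)) linear_sum.
transitivity (\sum_(k < \dim {:U}) \sum_(j < \dim {:U})
    (coord (vbasis {:U}) k u *: s (vbasis {:U})`_j) *
    \sum_i d i j * c i (vbasis {:U})`_k).
  apply: eq_bigr => k _; under eq_bigr do rewrite dual mulrC.
  by rewrite sum_delta linearZ.
rewrite exchange_big /=.
under [RHS]eq_bigr do rewrite mulr_suml.
rewrite [RHS]exchange_big; apply: eq_bigr => j _ /=.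
under eq_bigr do rewrite mulr_sumr; rewrite exchange_big; apply: eq_bigr => i _.
rewrite [in RHS](coord_vbasis (memvf u)) linear_sum mulr_sumr.
apply: eq_bigr => k _; rewrite linearZ /= -scalerAl -scalerAr; congr (_ *: _).
by rewrite mulrCA mulrA.
Qed.

(** Preimages that exist pointwise become a linear map through the pseudo-inverse of V -> L^I.
    Comultiplication, counit, antipode and the isomorphisms of structures are all obtained in this
    way. *)
Lemma lift_hom (W V : vectType K) (I : finType) (d : I -> 'Hom(V, L))
    (e : I -> 'Hom(W, L)) :
  (forall w, exists v, forall i, d i v = e i w) ->
  exists f : 'Hom(W, V), forall i w, d i (f w) = e i w.
Proof.
move=> ex.
have lin (X : vectType K) (b : I -> 'Hom(X, L)) :
    linear (fun x => [ffun i => b i x]).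
  by move=> k x y; apply/ffunP=> i; rewrite !ffunE linearP.
pose F (X : vectType K) (b : I -> 'Hom(X, L)) : {linear X -> {ffun I -> L}} :=
  HB.pack (fun x => [ffun i => b i x]) (GRing.isLinear.Build K _ _ _ _ (lin X b)).
exists ((linfun (F V d))^-1 \o linfun (F W e))%VF => i w.
rewrite comp_lfunE [linfun (F W e) w]lfunE; have [v dv] := ex w.
have : F W e w \in limg (linfun (F V d)).
  apply/memv_imgP; exists v; rewrite ?memvf // lfunE /=.
  by apply/ffunP=> j; rewrite !ffunE dv.
by move=> /limg_lfunVK /ffunP/(_ i); rewrite [linfun (F V d) _]lfunE !ffunE.
Qed.

Section Action.
Variables (I : finType) (sigma : G -> I -> I).
Hypothesis sigma1 : forall i, sigma 1%g i = i.
Hypothesis sigmaM : forall g k i, sigma (g * k)%g i = sigma k (sigma g i).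

Definition equivariant (v : I -> L) := forall g i, v (sigma g i) = g (v i).

Lemma sigmaVK g i : sigma g (sigma g^-1%g i) = i.
Proof. by rewrite -sigmaM mulVg sigma1. Qed.

Lemma sigmaK g i : sigma g^-1%g (sigma g i) = i.
Proof. by rewrite -sigmaM mulgV sigma1. Qed.

(* Independence of characters applied to the traces of the families supported
   on a single orbit. *)
Lemma trace_detects (U : vectType K) (c : I -> 'Hom(U, L)) (U' : {vspace U})
    (P : {set I}) :
  (forall g, {in P, forall i, sigma g i \in P}) ->
  (forall v, equivariant v -> (forall i, i \notin P -> v i = 0) ->
    exists2 u, u \in U' & forall i, c i u = v i) ->
  detects c U' P.
Proof.
move=> stabP surjc a a0 j jP.
suff /(_ 1%g) : forall g, a (sigma g j) = 0 by rewrite sigma1.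
move=> g; apply: (gal_detects (a := fun g => a (sigma g j))) => // l _ {g}.
pose v i := \sum_(g | sigma g j == i) (g : G) l.
have [k i||u uU cu] := surjc v.
- rewrite /v rmorph_sum (reindex (fun g => g * k)%g) /=; last first.
    by exists (fun g => g * k^-1)%g => g _; rewrite ?mulgK ?mulgKV.
  apply: eq_big => [g|g _]; last by rewrite galM ?memvf.
  by rewrite sigmaM (can_eq (sigmaK k)).
- move=> i iP; rewrite /v big1 // => g /eqP gi; move: iP.
  by rewrite -gi stabP.
rewrite -[RHS](a0 u uU); under [RHS]eq_bigr do rewrite cu mulr_sumr.
rewrite (partition_big (fun g => sigma g j) predT) //=; apply: eq_bigr => i _.
by apply: eq_bigr => g /eqP ->.
Qed.

Hypothesis galL : galois 1%VS {:L}.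

(* If \sum_j a_j e_j vanishes then so does \sum_j Tr(l a_j) e_j for every l,
   which has coefficients in K. *)
Lemma trace_separates (U : vectType K) (c : I -> 'Hom(U, L)) :
  (forall g i u, c (sigma g i) u = g (c i u)) ->
  (forall u, (forall i, c i u = 0) -> u = 0) -> separates c.
Proof.
move=> sigmac injc a a0 j.
rewrite -[LHS](gal_id {:L}).
apply: (gal_detects (a := fun g : G => g (a j))) => // l _.
have /fin_all_exists[k kE] (i : 'I_(\dim {:U})) :
    exists k : K, \sum_(g : G) g (a i) * g l = k%:A.
  apply: gal_fixed_scalar => // g.
  rewrite rmorph_sum [RHS](reindex_inj (mulIg g)); apply: eq_bigr => x _ /=.
  by rewrite rmorphM !galM ?memvf.
suff k0 : \sum_i k i *: (vbasis {:U})`_i = 0.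
  by rewrite kE (vbasis_eq0 k0) scale0r.
apply: injc => i; rewrite linear_sum.
transitivity (\sum_(j < \dim {:U}) \sum_(g : G)
    g (a j) * g l * c i (vbasis {:U})`_j).
  by apply: eq_bigr => m _; rewrite linearZ -mulr_suml kE mulr_algl.
rewrite exchange_big big1 // => g _ /=.
transitivity (g (l * \sum_j a j * c (sigma g^-1%g i) (vbasis {:U})`_j)).
  rewrite rmorphM rmorph_sum mulr_sumr; apply: eq_bigr => m _.
  by rewrite rmorphM /= -sigmac sigmaVK mulrCA mulrA.
by rewrite a0 mulr0 rmorph0.
Qed.

Section OneFamily.
Variables (U : vectType K) (c : I -> 'Hom(U, L)).
Hypothesis detc : detects c {:U} setT.
Hypothesis sepc : separates c.
Hypothesis sigmac : forall g i u, c (sigma g i) u = g (c i u).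

(** The system for [v] has a solution [a] over [L], unique because [c] separates. Equivariance makes
    every Galois conjugate of [a] a solution too, so [a] lies in [K]. *)
Lemma descent v : equivariant v -> exists u, forall i, c i u = v i.
Proof.
move=> eqv; have [a aE] := detects_solve v detc.
have /fin_all_exists[k kE] : forall j, exists k : K, a j = k%:A.
  move=> j; apply: gal_fixed_scalar => // g; apply/eqP; rewrite -subr_eq0.
  apply/eqP; move: j; apply: sepc => i; rewrite -[i](sigmaVK g).
  move: (sigma _ i) => {}i.
  under eq_bigr do rewrite mulrBl; rewrite sumrB aE eqv -aE rmorph_sum -sumrB.
  by rewrite big1 // => j _; apply/eqP; rewrite subr_eq0 sigmac rmorphM.
exists (\sum_j k j *: (vbasis {:U})`_j) => i.
rewrite linear_sum -aE; apply: eq_bigr => j _.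
by rewrite linearZ kE mulr_algl.
Qed.

End OneFamily.

(** Solve over [L] in the first slot with the second index [j] fixed. By uniqueness the solutions
    are equivariant in [j], so [descent] turns them into vectors [r k] of [V]. *)
Lemma descent_tens (U V : vectType K) (c : I -> 'Hom(U, L))
    (d : I -> 'Hom(V, L)) (v : I -> I -> L) :
  detects c {:U} setT -> separates c ->
  (forall g i u, c (sigma g i) u = g (c i u)) ->
  detects d {:V} setT -> separates d ->
  (forall g i u, d (sigma g i) u = g (d i u)) ->
  (forall g i j, v (sigma g i) (sigma g j) = g (v i j)) ->
  exists t, forall i j, ev c d i j t = v i j.
Proof.
move=> detc sepc sigc detd sepd sigd eqv.
have /fin_all_exists[a aE] j := detects_solve (v^~ j) detc.
have /fin_all_exists[r rE] k : exists w, forall j, d j w = a j k.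
  apply: descent => // g j; apply/eqP; rewrite -subr_eq0; apply/eqP.
  move: k; apply: sepc => i; rewrite -[i](sigmaVK g).
  move: (sigma _ i) => {}i.
  under eq_bigr do rewrite mulrBl; rewrite sumrB aE eqv -aE rmorph_sum -sumrB.
  by rewrite big1 // => k _; apply/eqP; rewrite subr_eq0 sigc rmorphM.
exists (\sum_(k < \dim {:U}) pure (vbasis {:U})`_k (r k)) => i j.
rewrite linear_sum -aE; apply: eq_bigr => k _.
by rewrite [LHS]ev_pure rE mulrC.
Qed.

End Action.
End Descent.

(** * Hopf subalgebras and left ideals *)

Section GaloisBrace.
Variables (K : fieldType) (L : splittingFieldType K).
Local Notation G := (gal_of {:L}).
Variable S : skew_brace G.
Hypothesis circS : gop (circ S) =2 @gal_comp K L.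

Lemma gid_gal : gid (circ S) = 1%g.
Proof.
have := gop1g (circ S) (gid (circ S)); rewrite circS /gal_comp.
by move/(canRL (mulgK _)); rewrite mulgV.
Qed.

Lemma gid_dot : gid (dot S) = 1%g.
Proof. by rewrite -gid_circ gid_gal. Qed.

Lemma gamma_gal1 x : gamma S 1%g x = x.
Proof. by rewrite -gid_gal gamma_id. Qed.

Lemma gamma_galM g k x : gamma S (g * k)%g x = gamma S k (gamma S g x).
Proof. by rewrite -gamma_circ circS. Qed.

Lemma dot_gal x y : gop (dot S) x (gamma S x y) = (y * x)%g.
Proof. by rewrite -circE circS. Qed.

Lemma gamma_quo x z : gamma S x (z * x^-1)%g = gop (dot S) (ginv (dot S) x) z.
Proof. by rewrite -[z in RHS](mulgKV x) -[in RHS]dot_gal gopK. Qed.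

Lemma gamma_stableP (C : {set G}) :
  (forall g, {in C, forall x, gamma S g x \in C}) <->
  (forall g, gamma S g @: C = C).
Proof.
split=> stabC g; last by move=> x xC; rewrite -(stabC g) imset_f.
apply/eqP; rewrite eqEcard card_imset ?leqnn ?andbT; last first.
  exact: can_inj (gammaK S g).
by apply/subsetP=> _ /imsetP[x xC ->]; apply: stabC.
Qed.

(** Since x . y = x o gamma_x^-1(y), gamma-stability transfers closure from [circ] to [dot];
    likewise the [dot]-inverse of x is gamma_x of its [circ]-inverse. *)
Lemma dot_subgroup (C : {group G}) :
  (forall g, {in C, forall x, gamma S g x \in C}) -> subgroup_for (dot S) C.
Proof.
move=> stabC; have mulC : {in C &, forall x y, gop (dot S) x y \in C}.
  move=> x y xC yC; rewrite -[y](gammaVK S x) dot_gal groupM //.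
  exact: stabC.
split=> // [|x xC]; first by rewrite gid_dot group1.
suff -> : ginv (dot S) x = gamma S x x^-1%g by rewrite stabC ?groupV.
by apply/esym/ginv_eq; rewrite dot_gal mulVg gid_dot.
Qed.

Lemma subgroup_gal (C : {set G}) :
  subgroup_for (dot S) C -> (forall g, {in C, forall x, gamma S g x \in C}) ->
  group_set C.
Proof.
case=> C1 CM _ stabC; apply/group_setP; split; first by rewrite -gid_dot.
by move=> x y xC yC; rewrite -dot_gal CM ?stabC.
Qed.

Lemma left_ideal_group (C : {group G}) :
  left_ideal S C <-> forall g, {in C, forall x, gamma S g x \in C}.
Proof.
split=> [[_ /gamma_stableP] //|stabC]; split; last exact/gamma_stableP.
by left; apply: dot_subgroup.
Qed.

End GaloisBrace.

Section Compatible.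
Variables (K : fieldType) (L : splittingFieldType K).
Hypothesis galL : galois 1%VS {:L}.
Local Notation G := (gal_of {:L}).

(** The relation that [S] is the skew brace attached to [T]. Stated as a relation, it lets the
    passages from [T] to [S] and from [S] to [T] share all lemmas below. *)
Definition compatible (S : skew_brace G) (T : hopf_galois L) :=
  gop (circ S) =2 @gal_comp K L /\
  forall g x h, pt T (gamma S g x) h = g (pt T x h).

Section OneStructure.
Variables (S : skew_brace G) (T : hopf_galois L).
Hypothesis compST : compatible S T.
Let circS := compST.1.
Let ptG := compST.2.
Local Notation "x ** y" := (gop (dot S) x y) (at level 40, left associativity).
Local Notation "x ^&" := (ginv (dot S) x) (at level 1, format "x ^&").

Lemma ptM z h k : pt T z (h * k) = \sum_x pt T x h * pt T (x^& ** z) k.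
Proof.
rewrite (ptM_circ galL); apply: eq_bigr => x _.
by rewrite -ptG gamma_quo.
Qed.

(** Write each point composed with the antipode as a combination of points with coefficients [p].
    Comparing coefficients in the axiom [antipodel] gives [pP], which leaves only the point at the
    [dot]-inverse. *)
Lemma pt_antipode x h : pt T x (antipode T h) = pt T x^& h.
Proof.
have /fin_all_exists[p pE] (y : G) : exists p : G -> L, forall h,
    pt T y (antipode T h) = \sum_w p w * pt T w h.
  have [p pE] := expand_points (pt T y \o linfun (antipode T))%VF
    (@pt_detects _ _ galL T) (@pt_separates _ _ galL T).
  by exists p => k; rewrite -pE [RHS]comp_lfunE; congr (pt T y _); rewrite lfunE.
have pP z : forall w, p (z ** w^&) w = (z == 1%g)%:R.
  move=> w; apply/eqP; rewrite -subr_eq0; apply/eqP.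
  apply: (pt_detects galL (T := T)
    (a := fun w => p (z ** w^&) w - (z == 1%g)%:R)) => // k _.
  under eq_bigr do rewrite mulrBl; rewrite sumrB -mulr_sumr (sum_pt galL).
  apply/eqP; rewrite subr_eq0; apply/eqP.
  transitivity (pt T z (counit T k)%:A); last first.
    by rewrite linearZ /= pt1 mulrC mulr_algl.
  rewrite -antipodel linear_tens_lift /=.
  under eq_tens_lift => u v do rewrite ptM.
  rewrite tens_lift_suml [RHS](reindex (fun w => z ** w^&)) /=; last first.
    exists (fun w => w^& ** z) => {}w _.
      by rewrite ginvM ginvK -gopA gopVg gopg1.
    by rewrite ginvM ginvK gopVK.
  apply: eq_bigr => {}w _; under eq_tens_lift => u v do rewrite pE mulr_suml.
  rewrite tens_lift_suml (bigD1 w) //= big1 ?addr0.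
    rewrite ginvM ginvK -gopA gopVg gopg1.
    under eq_tens_lift => u v do rewrite -mulrA.
    by rewrite -tens_liftMl [tens_lift _ _](ev_comul galL) eqxx mul1r.
  move=> y /negPf yw; rewrite ginvM ginvK -gopA gopVg gopg1.
  under eq_tens_lift => u v do rewrite -mulrA.
  by rewrite -tens_liftMl [tens_lift _ _](ev_comul galL) yw mul0r mulr0.
rewrite pE; have px w : p x w = (w == x^&)%:R.
  rewrite -[x in LHS](gopg1 (dot S)) -(gopgV (dot S) w) gopA pP.
  congr (nat_of_bool _)%:R.
  apply/eqP/eqP => [xw|->]; last by rewrite gopgV (gid_dot circS).
  by apply: ginv_eq; rewrite xw gid_dot.
by under eq_bigr do rewrite px; rewrite sum_delta.
Qed.

(** Over [L] the points identify [T] with the group algebra of (G, .), where the adjoint action is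
    conjugation: the coefficient of z in x k x^-1 is that of x^-1 z x in k. *)
Lemma pt_adjl z h k :
  pt T z (tens_lift (fun a b => a * k * antipode T b) (comul T h)) =
  \sum_x pt T x h * pt T (x^& ** (z ** x)) k.
Proof.
have E u v : pt T z (u * k * antipode T v) = \sum_x \sum_y
    pt T (x^& ** y) k * (pt T x u * pt T (z^& ** y) v).
  rewrite ptM exchange_big; apply: eq_bigr => y _.
  rewrite ptM mulr_suml; apply: eq_bigr => x _.
  by rewrite pt_antipode ginvM ginvK mulrAC mulrC.
rewrite linear_tens_lift /= (eq_tens_lift _ E) tens_lift_suml.
apply: eq_bigr => x _; rewrite tens_lift_suml.
under eq_bigr => y _ do
  rewrite -tens_liftMl [tens_lift _ _](ev_comul galL) mulrCA mulrC.
rewrite (bigD1 (z ** x)) //= gopK eqxx mulr1 mulrC big1 ?addr0 // => y yx.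
case: eqP => [xy|_]; last by rewrite mulr0.
by case/eqP: yx; rewrite xy gopVK.
Qed.

Lemma pt_adjr z h k :
  pt T z (tens_lift (fun a b => antipode T a * k * b) (comul T h)) =
  \sum_x pt T x h * pt T (x ** (z ** x^&)) k.
Proof.
have E u v : pt T z (antipode T u * k * v) = \sum_x \sum_y
    pt T (x ** y) k * (pt T x u * pt T (y^& ** z) v).
  rewrite ptM exchange_big; apply: eq_bigr => y _.
  rewrite ptM mulr_suml (reindex_inj (inv_inj (@ginvK _ (dot S)))) /=.
  apply: eq_bigr => x _.
  by rewrite pt_antipode ginvK mulrAC mulrC.
rewrite linear_tens_lift /= (eq_tens_lift _ E) tens_lift_suml.
apply: eq_bigr => x _; rewrite tens_lift_suml.
under eq_bigr => y _ do
  rewrite -tens_liftMl [tens_lift _ _](ev_comul galL) mulrCA mulrC.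
rewrite (bigD1 (z ** x^&)) //= ginvM ginvK -gopA gopVg gopg1.
rewrite eqxx mulr1 mulrC big1 ?addr0 // => y yx.
case: eqP => [xy|_]; last by rewrite mulr0.
by case/eqP: yx; rewrite xy ginvM ginvK gopVK.
Qed.

(* The L-span of H' inside L^G is L^C. *)
Definition carries (H' : {vspace T}) (C : {set G}) :=
  (forall h x, h \in H' -> x \notin C -> pt T x h = 0) /\ detects (pt T) H' C.

Lemma carries_neq0 H' C x : carries H' C -> x \in C ->
  ~ {in H', forall h, pt T x h = 0}.
Proof.
case=> _ detC xC x0; have /eqP := oner_eq0 L; case.
have <- := detC (fun y => (y == x)%:R) _ x xC; first by rewrite eqxx.
by move=> h hH; rewrite sum_delta x0.
Qed.

(** Since the points of h sum to its counit, h(a) - counit(h) a is the combination of the points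
    with coefficients x(a) - a. Such a combination vanishes on H' exactly when these coefficients
    vanish on C. *)
Lemma carries_fixed H' C a : carries H' C ->
  {in H', forall h, hg_act T h a = counit T h *: a} <->
  {in C, forall x : G, x a = a}.
Proof.
move=> [suppC detC].
have E h : hg_act T h a - counit T h *: a = \sum_(x : G) (x a - a) * pt T x h.
  rewrite (hg_actE galL) -[_ *: a]mulr_algl -(sum_pt galL) mulr_suml -sumrB.
  by apply: eq_bigr => x _; rewrite -mulrBr mulrC.
split=> [fixa x xC|fixa h hH].
  apply/eqP; rewrite -subr_eq0; apply/eqP.
  by apply: (detC (fun x => x a - a)) xC => h hH; rewrite -E fixa ?subrr.
apply/eqP; rewrite -subr_eq0 E big1 // => x _.
have [xC|xC] := boolP (x \in C); first by rewrite fixa ?subrr ?mul0r.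
by rewrite suppC ?mulr0.
Qed.

Definition supported (C : {set G}) : {vspace T} :=
  (\bigcap_(x | x \notin C) lker (pt T x))%VS.

Lemma supportedP (C : {set G}) h :
  reflect (forall x, x \notin C -> pt T x h = 0) (h \in supported C).
Proof.
apply: (iffP idP) => [hC x xC|h0].
  apply/eqP; rewrite -memv_ker; apply: subvP hC.
  exact: (bigcapv_inf x xC (subvv _)).
rewrite memvE; apply/subv_bigcapP => x xC; rewrite -memvE memv_ker.
by rewrite h0.
Qed.

Lemma supported_carries (C : {set G}) :
  (forall g, {in C, forall x, gamma S g x \in C}) -> carries (supported C) C.
Proof.
move=> stabC; split=> [h x /supportedP hC|]; first exact: hC.
apply: (trace_detects (gamma_gal1 circS) (gamma_galM circS)) => // v eqv v0.
have [u uE] := descent (gamma_gal1 circS) (gamma_galM circS) galL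
  (@pt_detects _ _ galL T) (@pt_separates _ _ galL T) ptG eqv.
by exists u => //; apply/supportedP => x xC; rewrite uE v0.
Qed.

Lemma supported_hopf_subalgebra (C : {set G}) :
  subgroup_for (dot S) C -> (forall g, {in C, forall x, gamma S g x \in C}) ->
  hopf_subalgebra (supported C).
Proof.
move=> [C1 CM CV] stabC; split.
- apply/supportedP => x xC; rewrite pt1; case: eqP => // x1.
  by rewrite x1 -(gid_dot circS) C1 in xC.
- move=> h k /supportedP hC /supportedP kC; apply/supportedP => z zC.
  rewrite ptM big1 // => x _; have [xC|xC] := boolP (x \in C).
    rewrite kC ?mulr0 //; apply: contra zC => yC.
    by rewrite -[z](gopVK (dot S) x) CM.
  by rewrite hC ?mul0r.
- move=> h /supportedP hC; apply: mem_tens_sub => k; apply/supportedP => y yC.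
    apply: ev_slice_eq0 (@pt_separates _ _ galL T) _ k => x.
    rewrite (ev_comul galL); case: eqP => [->|_]; last by rewrite mul0r.
    by rewrite hC ?mulr0.
  apply: ev_slice_eq0 (@pt_separates _ _ galL T) _ k => x.
  transitivity (ev (pt T) (pt T) y x (comul T h)).
    rewrite /ev /tens_lift exchange_big; apply: eq_bigr => i _.
    by apply: eq_bigr => j _; rewrite mxE mulrC.
  by rewrite (ev_comul galL) hC ?mulr0.
- move=> h /supportedP hC; apply/supportedP => x xC; rewrite pt_antipode hC //.
  by apply: contra xC => /CV; rewrite ginvK.
Qed.

Lemma supported_normal (C : {set G}) :
  normal_subgroup_for (dot S) C ->
  (forall g, {in C, forall x, gamma S g x \in C}) ->
  normal_hopf_subalgebra (supported C).
Proof.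
move=> [sgC nC] stabC; split; first exact: supported_hopf_subalgebra.
move=> h k /supportedP kC; split; apply/supportedP => z zC.
  rewrite pt_adjl big1 // => x _; rewrite kC ?mulr0 //; apply: contra zC.
  by move=> /(nC x); rewrite gopVK -gopA gopgV gopg1.
rewrite pt_adjr big1 // => x _; rewrite kC ?mulr0 //; apply: contra zC.
move=> /(nC x^&); rewrite ginvK.
by rewrite gopK -gopA gopVg gopg1.
Qed.

Section HopfSub.
Variable H' : {vspace T}.
Hypothesis subH : hopf_subalgebra H'.

Definition support_of : {set G} := [set x | ~~ (H' <= lker (pt T x))%VS].

Lemma support_ofP x :
  reflect (exists2 h, h \in H' & pt T x h != 0) (x \in support_of).
Proof.
rewrite inE; apply: (iffP idP) => [/subvPn[h hH xh]|[h hH xh]].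
  by exists h; rewrite -?memv_ker.
by apply/subvPn; exists h; rewrite ?memv_ker.
Qed.

Lemma notin_support_of h x : h \in H' -> x \notin support_of -> pt T x h = 0.
Proof.
move=> hH xC; apply/eqP; apply: contraR xC => xh.
by apply/support_ofP; exists h.
Qed.

(** Apply (\sum_y a_y c_y) (x) c_x to the comultiplication of h, which lies in H' (x) H'. The
    relation makes the result zero, and orthogonality of the points makes it a_x c_x(h); choose h
    with c_x(h) nonzero. *)
Lemma support_of_carries : carries H' support_of.
Proof.
split=> [h x|a a0 x /support_ofP[h hH nz_xh]]; first exact: notin_support_of.
have [_ _ comulH _] := subH.
have : tens_lift (fun u v => (\sum_y a y * pt T y u) * pt T x v) (comul T h) = 0.
  apply: tens_lift_sub (comulH h hH) => [u|v|u v uH vH].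
  - by move=> k v w; rewrite linearP mulrDr scalerAr.
  - move=> k u w; rewrite scalerAl -mulrDl scaler_sumr -big_split.
    by congr (_ * _); apply: eq_bigr => y _ /=; rewrite linearP mulrDr scalerAr.
  - by rewrite a0 ?mul0r.
under eq_tens_lift => u v do rewrite mulr_suml.
rewrite tens_lift_suml.
under eq_bigr => y _ do under eq_tens_lift => u v do rewrite -mulrA.
under eq_bigr => y _ do
  rewrite -tens_liftMl [tens_lift _ _](ev_comul galL) mulrCA.
by rewrite sum_delta => /eqP; rewrite mulf_eq0 (negPf nz_xh) orbF => /eqP.
Qed.

Lemma support_of_stable g :
  {in support_of, forall x, gamma S g x \in support_of}.
Proof.
move=> x /support_ofP[h hH xh]; apply/support_ofP; exists h => //.
by rewrite ptG fmorph_eq0.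
Qed.

Lemma support_of_subgroup : subgroup_for (dot S) support_of.
Proof.
have [H1 HM _ HS] := subH; split.
- apply/support_ofP; exists 1 => //.
  by rewrite (gid_dot circS) pt1 eqxx oner_neq0.
- move=> x y xC yC; apply/contraT => xyC.
  case: (carries_neq0 support_of_carries yC) => k kH.
  rewrite -[y](gopK (dot S) x).
  (* If x . y were outside the support, the expansion of [pt T (x ** y) (h * k)] would be a
     vanishing relation in h; its coefficient at w = x is the value at y of k. *)
  apply: (support_of_carries.2 (fun w => pt T (w^& ** (x ** y)) k)) xC => h hH.
  under eq_bigr do rewrite mulrC.
  by rewrite -ptM notin_support_of ?HM.
- move=> x /support_ofP[h hH xh]; apply/support_ofP.
  by exists (antipode T h); rewrite ?HS // pt_antipode ginvK.
Qed.

Lemma support_of_normal : normal_hopf_subalgebra H' ->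
  normal_subgroup_for (dot S) support_of.
Proof.
case=> _ nH; split=> [|g y yC]; first exact: support_of_subgroup.
apply/contraT => gyC; case: (carries_neq0 support_of_carries yC) => k kH.
have -> : y = g^& ** (g ** y ** g^& ** g).
  by rewrite -!gopA gopK gopVg gopg1.
(* The left adjoint action keeps k in H', so its value at g . y . g^-1 vanishes for every h; the
   coefficient at w = g of this relation is the value at y of k. *)
apply: (pt_detects galL (T := T)
  (a := fun w => pt T (w^& ** (g ** y ** g^& ** w)) k)) => // h _.
under eq_bigr do rewrite mulrC.
by rewrite -pt_adjl notin_support_of //; case: (nH h k kH).
Qed.

(** The support is a subgroup whose fixed field is the realised field, so the Galois correspondence
    identifies it with the given group. *)
Lemma support_of_group (B : {group G}) :
  realises_via H' (fixedField B) -> support_of = B.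
Proof.
move=> realB.
pose C := Group (subgroup_gal circS support_of_subgroup support_of_stable).
suff CB : fixedField C = fixedField B.
  by rewrite -[RHS](gal_fixedField B) -CB (gal_fixedField C).
apply/vspaceP => a; apply/idP/idP.
  move=> /mem_fixedFieldP[_ fixa]; apply/realB.
  by apply/(carries_fixed _ support_of_carries).
move=> /realB /(carries_fixed _ support_of_carries) fixa.
by apply/fixedFieldP; rewrite ?memvf.
Qed.

End HopfSub.

Lemma realises_supported (B : {group G}) :
  (forall g, {in B, forall x, gamma S g x \in B}) ->
  realises_via (supported B) (fixedField B).
Proof.
move=> /supported_carries carB a; split.
  by move=> /mem_fixedFieldP[_ fixa]; apply/(carries_fixed _ carB).
by move=> /(carries_fixed _ carB) fixa; apply/fixedFieldP; rewrite ?memvf.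
Qed.

End OneStructure.
End Compatible.

(** * Realised fields and isomorphisms *)

Section Realisation.
Variables (K : fieldType) (L : splittingFieldType K).
Hypothesis galL : galois 1%VS {:L}.
Local Notation G := (gal_of {:L}).
Variables (S : skew_brace G) (T : hopf_galois L).
Hypothesis compST : compatible S T.
Variables A B : {group G}.
Hypothesis semidirectAB : (A ><| B)%g = 'Gal({:L} / 1)%g.

Lemma realises_left_ideal (C : {group G}) :
  (exists H' : {vspace T}, hopf_subalgebra H' /\ realises_via H' (fixedField C))
  <-> left_ideal S C.
Proof.
split=> [[H' [subH realC]]|/(left_ideal_group compST.1) stabC].
  apply/(left_ideal_group compST.1).
  by rewrite -(support_of_group galL compST subH realC); apply: support_of_stable.
exists (supported T C); split; last exact: realises_supported compST _ _.
apply: supported_hopf_subalgebra compST _ _ _ => //.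
exact: dot_subgroup compST.1 _ _.
Qed.

Lemma realises_normal_left_ideal (C : {group G}) :
  (exists H' : {vspace T},
    normal_hopf_subalgebra H' /\ realises_via H' (fixedField C))
  <-> left_ideal S C /\ normal_subgroup_for (dot S) C.
Proof.
split=> [[H' [nH realC]]|[liC nC]].
  split; first by apply/realises_left_ideal; exists H'; split=> //; case: nH.
  rewrite -(support_of_group galL compST nH.1 realC).
  exact (support_of_normal galL compST nH.1 nH).
move/(left_ideal_group compST.1): liC => stabC.
exists (supported T C); split; last exact: realises_supported compST _ _.
exact: supported_normal compST _ _ _.
Qed.

(** The clauses on [circ] come from the given decomposition of the Galois group. For A . B = G one
    counts: trivial intersection makes (a, b) -> a . b injective, and |A| |B| = |G|. *)
Lemma realises_semidirectP :
  realises_semidirect A B T <-> internal_semidirect S A B.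
Proof.
have circS := compST.1.
split=> [[/realises_normal_left_ideal[liA nA] /realises_left_ideal liB]|].
  2: by case=> -[liA nA _] liB _ _ _; split;
    [apply/realises_normal_left_ideal|apply/realises_left_ideal].
have [nAG _ mulAB nAB tiAB] := sdprod_context semidirectAB.
(* [gal_comp] reverses [*], so the products of A with B for [circ] form [B * A]. *)
have mulBA : (B * A)%g = [set: G]
  by rewrite (normC nAB) mulAB; apply: Gal1f.
have stabA := (left_ideal_group circS A).1 liA.
have stabB := (left_ideal_group circS B).1 liB.
have [_ AM AV] := dot_subgroup circS stabA.
have [_ BM BV] := dot_subgroup circS stabB.
split=> //.
- split=> //; split=> [|g a aA].
    split=> [|x y xA yA|x xA]; first by rewrite (gid_gal circS).
      by rewrite circS groupM.
    rewrite (_ : ginv _ x = x^-1)%g ?groupV //.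
    apply/esym/ginv_eq; rewrite circS /gal_comp mulVg; exact/esym/gid_gal.
  have gV : ginv (circ S) g = g^-1%g.
    by apply/esym/ginv_eq; rewrite circS /gal_comp mulVg; apply/esym/gid_gal.
  rewrite gV !circS /gal_comp.
  rewrite -conjgE memJ_norm //.
  have: g \in [set: G] by rewrite inE.
  by rewrite -Gal1f; apply/subsetP/normal_norm.
- by rewrite (gid_dot circS) tiAB.
- apply/eqP; rewrite eqEcard subsetT /= cardsT.
  have inj : {in setX A B &, injective (fun p => gop (dot S) p.1 p.2)}.
    move=> [a b] [a' b'] /setXP[/= aA bB] /setXP[/= aA' bB'] eqab.
    have : gop (dot S) (ginv (dot S) a') a \in A :&: B.
      rewrite inE AM ?AV //=.
      have -> : gop (dot S) (ginv (dot S) a') a = gop (dot S) b' (ginv (dot S) b).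
        apply: (@gopIr _ (dot S) b); rewrite -!gopA eqab gopK gopVg gopg1 //.
      by rewrite BM ?BV.
    rewrite tiAB inE => /eqP aa'; have Ea : a = a'.
      by rewrite -(gopVK (dot S) a' a) aa' -(gid_dot circS) gopg1.
    by move: eqab => /=; rewrite Ea => /(@gopI _ (dot S)) ->.
  have -> : [set gop (dot S) a b | a in A, b in B] =
      [set gop (dot S) p.1 p.2 | p in setX A B].
    apply/setP=> x; apply/imset2P/imsetP.
      by case=> a b aA bB ->; exists (a, b) => //; apply/setXP.
    by case=> -[a b] /setXP[/= aA bB] ->; exists a b.
  by rewrite card_in_imset // cardsX (sdprod_card semidirectAB) -cardsT -Gal1f.
- apply/setP=> x; rewrite inE; have: x \in (B * A)%g by rewrite mulBA inE.
  case/mulsgP => b a bB aA ->; apply/imset2P; exists a b => //;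
    by rewrite circS.
Qed.

End Realisation.

Section Isomorphism.
Variables (K : fieldType) (L : splittingFieldType K).
Hypothesis galL : galois 1%VS {:L}.
Local Notation G := (gal_of {:L}).

Lemma gamma_dot (S S' : skew_brace G) :
  gop (circ S) =2 gop (circ S') -> gop (dot S) =2 gop (dot S') ->
  gamma S =2 gamma S'.
Proof.
move=> eqc eqd x y; apply: (@gopI _ (dot S) x).
by rewrite -circE eqd -circE eqc.
Qed.

Lemma dot_gamma (S S' : skew_brace G) :
  gop (circ S) =2 gop (circ S') -> gamma S =2 gamma S' ->
  gop (dot S) =2 gop (dot S').
Proof.
move=> eqc eqg x y; rewrite -[y](gammaVK S x).
by move: (gamma S _ y) => z; rewrite -circE eqg -circE eqc.
Qed.

Variables (S S' : skew_brace G) (T T' : hopf_galois L).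
Hypothesis compST : compatible S T.
Hypothesis compST' : compatible S' T'.
Let eqcirc : gop (circ S) =2 gop (circ S').
Proof. by move=> x y; rewrite compST.1 compST'.1. Qed.

(** An isomorphism preserves the actions on [L], hence the points, hence the Galois action on the
    points, which is gamma; and gamma together with [circ] determines [dot]. *)
Lemma hg_iso_dot : hg_iso T T' -> gop (dot S) =2 gop (dot S').
Proof.
case=> f [[f' fK f'K] _ _ _ fact]; apply: dot_gamma => // g x.
have ptf y h : pt T' y (f h) = pt T y h.
  rewrite !ptE; congr (cf y _); apply/lfunP => a; exact: fact.
have E h : pt T' (gamma S g x) h = pt T' (gamma S' g x) h.
  by rewrite -[h]f'K !ptf compST.2 -ptf -compST'.2 ptf.
exact: (pt_inj galL E).
Qed.

(** Equal operations give equal gamma, so the values at all points of an element of either structure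
    descend to an element of the other. The isomorphism axioms are then checked on points. *)
Lemma dot_hg_iso : gop (dot S) =2 gop (dot S') -> hg_iso T T'.
Proof.
move=> eqdot; have eqg := gamma_dot eqcirc eqdot.
have galg1 := gamma_gal1 compST.1; have galgM := gamma_galM compST.1.
have sepT := pt_separates galL (T := T); have detT := pt_detects galL (T := T).
have sepT' := pt_separates galL (T := T').
have detT' := pt_detects galL (T := T').
have compG : forall g x h, pt T' (gamma S g x) h = g (pt T' x h).
  by move=> g x h; rewrite eqg compST'.2.
have [f fE] : exists f : 'Hom(T, T'), forall x h, pt T' x (f h) = pt T x h.
  apply: lift_hom => h.
  exact: (descent galg1 galgM galL detT' sepT' compG (fun g x => compST.2 g x h)).
have [f' f'E] : exists f' : 'Hom(T', T), forall x h, pt T x (f' h) = pt T' x h.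
  apply: lift_hom => h.
  exact: (descent galg1 galgM galL detT sepT compST.2 (fun g x => compG g x h)).
have fM : monoid_morphism f.
  split=> [|h k]; apply: (separates_inj sepT') => x; rewrite fE ?pt1 //.
  by rewrite !(ptM_circ galL); apply: eq_bigr => y _; rewrite !fE.
pose F : {lrmorphism T -> T'} :=
  HB.pack (fun h => f h) (GRing.isLinear.Build _ _ _ _ (fun h => f h) (linearP f))
    (GRing.isMonoidMorphism.Build _ _ (fun h => f h) fM).
have FE h : F h = f h by [].
exists F; split.
- exists f' => h.
    by apply: (separates_inj sepT) => x; rewrite f'E FE fE.
  by apply: (separates_inj sepT') => x; rewrite FE fE f'E.
- move=> h; apply: (ev_inj (c := pt T') (d := pt T')) => // [v v0|x y].
    exact: separates_eq0 sepT' v0.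
  rewrite (ev_comul galL) linear_tens_lift /=.
  under eq_tens_lift => u v do rewrite ev_pure !fE.
  by rewrite fE [RHS](ev_comul galL).
- move=> h; apply: (fmorph_inj (in_alg L)); rewrite /= -!(sum_pt galL).
  by apply: eq_bigr => x _; rewrite fE.
- move=> h; apply: (separates_inj sepT') => x.
  rewrite (pt_antipode galL compST') !fE (pt_antipode galL compST).
  congr (pt T _ h); apply/esym/ginv_eq.
  by rewrite -eqdot gopgV (gid_dot compST'.1) (gid_dot compST.1).
- move=> h a; rewrite !(hg_actE galL); apply: eq_bigr => x _.
  by rewrite fE.
Qed.

End Isomorphism.

(** * The skew brace of a Hopf-Galois structure *)

Section BraceOfStructure.
Variables (K : fieldType) (L : splittingFieldType K).
Hypothesis galL : galois 1%VS {:L}.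
Local Notation G := (gal_of {:L}).
Variable T : hopf_galois L.

(** Expand g composed with the point y over the points, with coefficients [p y x]. For fixed x,
    comultiplication and counit make them orthogonal idempotents of the field [L] with sum 1, so
    exactly one of them is 1. *)
Lemma gal_permutes_points (g : G) :
  exists s : G -> G, forall x h, g (pt T (s x) h) = pt T x h.
Proof.
have /fin_all_exists[p pE] (y : G) : exists p : G -> L, forall h,
    g (pt T y h) = \sum_x p x * pt T x h.
  have [p pE] := expand_points (gal_repr g \o pt T y)%VF
    (@pt_detects _ _ galL T) (@pt_separates _ _ galL T).
  by exists p => h; rewrite -pE [RHS]comp_lfunE.
have orth y z x : p y x * p z x = (y == z)%:R * p y x.
  apply/eqP; rewrite -subr_eq0; apply/eqP.
  apply: (pt_detects galL (T := T)
    (a := fun x => p y x * p z x - (y == z)%:R * p y x)) => // h _.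
  under eq_bigr do rewrite mulrBl; rewrite sumrB.
  under [X in _ - X]eq_bigr do rewrite -mulrA.
  rewrite -[X in _ - X]mulr_sumr -pE; apply/eqP; rewrite subr_eq0; apply/eqP.
  transitivity (g (ev (pt T) (pt T) y z (comul T h))); last first.
    by rewrite (ev_comul galL) rmorphM rmorph_nat.
  have E u v : g (pt T y u * pt T z v) =
      \sum_x \sum_w p y x * p z w * (pt T x u * pt T w v).
    rewrite rmorphM /= !pE mulr_suml; apply: eq_bigr => w _.
    by rewrite mulr_sumr; apply: eq_bigr => w' _; rewrite mulrACA.
  rewrite linear_tens_lift /= (eq_tens_lift _ E) tens_lift_suml.
  apply: eq_bigr => w _; rewrite tens_lift_suml.
  under eq_bigr => w' _ do
    rewrite -tens_liftMl [tens_lift _ _](ev_comul galL) mulrCA eq_sym.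
  by rewrite sum_delta.
have sum1 x : \sum_y p y x = 1.
  apply/eqP; rewrite -subr_eq0; apply/eqP.
  apply: (pt_detects galL (T := T) (a := fun x => \sum_y p y x - 1)) => // h _.
  under eq_bigr do rewrite mulrBl mulr_suml mul1r; rewrite sumrB exchange_big.
  under eq_bigr do rewrite -pE.
  by rewrite -rmorph_sum (sum_pt galL) /= linearZ /= rmorph1 subrr.
have /fin_all_exists[s sE] x : exists s, forall y, p y x = (y == s)%:R.
  have [s nz_s] : exists s, p s x != 0.
    apply/existsP; apply: contraT; rewrite negb_exists => /forallP p0.
    have := sum1 x; rewrite big1 => [/esym/eqP|y _]; first by rewrite oner_eq0.
    exact/eqP/negbNE/p0.
  exists s => y; apply: (mulIf nz_s); rewrite orth; case: eqP => [->|_] //.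
  by rewrite !mul0r.
have gE y h : g (pt T y h) = \sum_x (y == s x)%:R * pt T x h.
  by rewrite pE; apply: eq_bigr => x _; rewrite sE.
(* If y were missed by [s], then g would kill the point at y, so that point would vanish
   identically, against independence. *)
have /fin_all_exists[r rK] y : exists x, s x = y.
  have [/codomP[x ->]|ys] := boolP (y \in codom s); first by exists x.
  have /eqP := oner_eq0 L; case.
  transitivity ((y == y)%:R : L); first by rewrite eqxx.
  apply: (pt_detects galL (T := T) (a := fun x => (x == y)%:R)) => // h _.
  rewrite sum_delta; apply/eqP; rewrite -(fmorph_eq0 g) /= gE big1 // => x _.
  by case: eqP ys => [->|_ _]; rewrite ?codom_f ?mul0r.
have sK : cancel s r by apply/(bij_can_sym (injF_bij (can_inj rK))).
exists s => x h; rewrite gE.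
under eq_bigr do rewrite (can_eq sK) eq_sym.
by rewrite sum_delta.
Qed.

Lemma exists_gamma : exists gam : G -> G -> G,
  forall g x h, pt T (gam g x) h = g (pt T x h).
Proof.
have /fin_all_exists[s sE] := gal_permutes_points.
(* The permutation [s g] describes the action of the inverse of g on the points. *)
exists (fun g => s g^-1%g) => g x h.
by rewrite -[in RHS](sE g^-1%g) -galM ?memvf // mulVg gal_id.
Qed.

Variable gam : G -> G -> G.
Hypothesis gamP : forall g x h, pt T (gam g x) h = g (pt T x h).

Lemma gam1 x : gam 1%g x = x.
Proof. by apply: (pt_inj galL (T := T)) => h; rewrite gamP gal_id. Qed.

Lemma gamM g k x : gam (g * k)%g x = gam k (gam g x).
Proof. by apply: (pt_inj galL (T := T)) => h; rewrite !gamP galM ?memvf. Qed.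

Lemma gamVK g x : gam g^-1%g (gam g x) = x.
Proof. by rewrite -gamM mulgV gam1. Qed.

Lemma gamKV g x : gam g (gam g^-1%g x) = x.
Proof. by rewrite -gamM mulVg gam1. Qed.

Lemma gam_id g : gam g 1%g = 1%g.
Proof.
apply/eqP; have : (gam g 1%g == 1%g)%:R = 1 :> L.
  by rewrite -(pt1 T) gamP pt1 eqxx rmorph1.
by case: eqP => // _ /esym/eqP; rewrite oner_eq0.
Qed.

(* x . y = x o gamma_x^-1(y), where o is gal_comp. *)
Definition brace_mul x y : G := (gam x^-1%g y * x)%g.

(** The point at gam_g(z) of a product can be expanded directly, or as g applied to the expansion at
    z; compare coefficients. As gam_x(z x^-1) is x^-1 . z, this says that gam_g respects the future
    operation [brace_mul]. *)
Lemma gam_quo g x z :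
  gam (gam g x) (gam g z * (gam g x)^-1)%g = gam g (gam x (z * x^-1)%g).
Proof.
apply: (pt_inj galL (T := T)) => k; apply/eqP; rewrite -subr_eq0; apply/eqP.
rewrite -[x in X in _ - X](gamVK g).
apply: (pt_detects galL (T := T) (a := fun w =>
  pt T (gam w (gam g z * w^-1)%g) k -
  pt T (gam g (gam (gam g^-1%g w) (z * (gam g^-1%g w)^-1)%g)) k)) => // h _.
have gam_inj : injective (gam g) by exact: can_inj (gamVK g).
under eq_bigr do rewrite mulrBl; rewrite sumrB.
rewrite [X in _ - X](reindex_inj gam_inj) /=.
under [X in _ - X]eq_bigr do rewrite gamVK !gamP mulrC.
under eq_bigr do rewrite gamP mulrC.
rewrite -(ptM_circ galL) gamP (ptM_circ galL) rmorph_sum -sumrB big1 // => u _.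
by rewrite rmorphM subrr.
Qed.

Lemma gam_mul g x y : gam g (brace_mul x y) = brace_mul (gam g x) (gam g y).
Proof.
apply: (canRL (mulgKV _)); apply: (can_inj (gamVK (gam g x))); rewrite gamKV.
by rewrite gam_quo /brace_mul mulgK gamKV.
Qed.

Lemma brace_mulA : associative brace_mul.
Proof.
move=> x y z; rewrite {1}/brace_mul gam_mul /brace_mul invMg gamM.
by rewrite mulgA.
Qed.

Lemma brace_mul1g : left_id 1%g brace_mul.
Proof. by move=> x; rewrite /brace_mul invg1 gam1 mulg1. Qed.

Lemma brace_mulg1 : right_id 1%g brace_mul.
Proof. by move=> x; rewrite /brace_mul gam_id mul1g. Qed.

Definition brace_inv x : G := gam x x^-1%g.

Lemma brace_mulgV : right_inverse 1%g brace_inv brace_mul.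
Proof. by move=> x; rewrite /brace_mul /brace_inv gamVK mulVg. Qed.

Lemma brace_mulVg : left_inverse 1%g brace_inv brace_mul.
Proof.
move=> x; rewrite -[x in brace_mul _ x]brace_mulg1.
rewrite -(brace_mulgV (brace_inv x)) [brace_mul x _]brace_mulA brace_mulgV.
by rewrite brace_mul1g.
Qed.

Definition brace_dot := GroupLaw brace_mulA brace_mul1g brace_mulg1
  brace_mulVg brace_mulgV.

Fact gal_compA : associative (@gal_comp K L).
Proof. by move=> x y z; rewrite /gal_comp mulgA. Qed.

Definition gal_law : group_law G := @GroupLaw G (@gal_comp K L) 1%g invg
  gal_compA (@mulg1 _) (@mul1g _) (@mulgV _) (@mulVg _).

Lemma brace_mul_gam x y : brace_mul x (gam x y) = (y * x)%g.
Proof. by rewrite /brace_mul gamVK. Qed.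

Fact brace_dotP x y z :
  gop gal_law x (gop brace_dot y z) =
  gop brace_dot (gop brace_dot (gop gal_law x y) (ginv brace_dot x))
    (gop gal_law x z).
Proof.
rewrite /= /gal_comp -!brace_mul_gam gam_mul.
by rewrite -brace_mulA [brace_mul (brace_inv x) _]brace_mulA brace_mulVg
  brace_mul1g brace_mulA.
Qed.

Definition point_brace := SkewBrace brace_dotP.

Lemma point_brace_compatible : compatible point_brace T.
Proof.
split=> // g x h; rewrite -gamP /gamma /=; congr (pt T _ h).
by rewrite /gal_comp -brace_mul_gam brace_mulA brace_mulVg brace_mul1g.
Qed.

End BraceOfStructure.

Lemma exists_compatible_brace (K : fieldType) (L : splittingFieldType K)
    (galL : galois 1%VS {:L}) (T : hopf_galois L) :
  exists S, compatible S T.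
Proof.
have [gam gamP] := exists_gamma galL T.
by exists (point_brace galL gamP); apply: point_brace_compatible.
Qed.

(** * The Hopf-Galois structure of a skew brace *)

Section CompositionAlgebra.
Variables (K : fieldType) (L : falgType K) (V : {vspace 'End(L)}).

(* The ring structure that FalgLfun puts on 'End(L) has the opposite
   multiplication, hence this separate construction. *)
Definition comp_closed := (\1%VF \in V) /\
  {in V &, forall f g, (f \o g)%VF \in V}.

(** Indexing the type by the closure proof lets the ring structures below, which rely on that proof,
    be attached to it. *)
Definition comp_alg of comp_closed := subvs_of V.

Variable closedV : comp_closed.
Local Notation H := (comp_alg closedV).

HB.instance Definition _ := Vector.on H.

Definition comp_mul (f g : H) : H := vsproj V (vsval f \o vsval g)%VF.

Lemma val_comp_mul f g : vsval (comp_mul f g) = (vsval f \o vsval g)%VF.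
Proof. by rewrite vsprojK // closedV.2 ?subvsP. Qed.

Definition comp_one : H := vsproj V \1%VF.

Lemma val_comp_one : vsval comp_one = \1%VF.
Proof. by rewrite vsprojK // closedV.1. Qed.

Fact comp_mulA : associative comp_mul.
Proof. by move=> f g h; apply: subvs_inj; rewrite !val_comp_mul comp_lfunA. Qed.

Fact comp_mul1 : left_id comp_one comp_mul.
Proof.
by move=> f; apply: subvs_inj; rewrite val_comp_mul val_comp_one comp_lfun1l.
Qed.

Fact comp_mulr1 : right_id comp_one comp_mul.
Proof.
by move=> f; apply: subvs_inj; rewrite val_comp_mul val_comp_one comp_lfun1r.
Qed.

Fact comp_mulDl : left_distributive comp_mul +%R.
Proof.
move=> f g h; apply: subvs_inj.
by rewrite linearD /= !val_comp_mul linearD comp_lfunDl.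
Qed.

Fact comp_mulDr : right_distributive comp_mul +%R.
Proof.
move=> f g h; apply: subvs_inj.
by rewrite linearD /= !val_comp_mul linearD comp_lfunDr.
Qed.

Fact comp_one_neq0 : comp_one != 0.
Proof.
apply/eqP => /(congr1 vsval); rewrite val_comp_one linear0 => /lfunP/(_ 1).
by rewrite id_lfunE zero_lfunE => /eqP; rewrite oner_eq0.
Qed.

HB.instance Definition _ := GRing.Zmodule_isNzRing.Build H
  comp_mulA comp_mul1 comp_mulr1 comp_mulDl comp_mulDr comp_one_neq0.

Fact comp_scaleAl k (f g : H) : k *: (f * g) = (k *: f) * g.
Proof.
by apply: subvs_inj; rewrite linearZ /= !val_comp_mul linearZ comp_lfunZl.
Qed.

HB.instance Definition _ := GRing.Lmodule_isLalgebra.Build K H comp_scaleAl.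

Fact comp_scaleAr k (f g : H) : k *: (f * g) = f * (k *: g).
Proof.
by apply: subvs_inj; rewrite linearZ /= !val_comp_mul linearZ comp_lfunZr.
Qed.

HB.instance Definition _ := GRing.Lalgebra_isAlgebra.Build K H comp_scaleAr.
HB.instance Definition _ := Algebra_isFalgebra.Build K H.

End CompositionAlgebra.

Section StructureOfBrace.
Variables (K : fieldType) (L : splittingFieldType K).
Hypothesis galL : galois 1%VS {:L}.
Local Notation G := (gal_of {:L}).
Variable S : skew_brace G.
Hypothesis circS : gop (circ S) =2 @gal_comp K L.
Local Notation "x ** y" := (gop (dot S) x y) (at level 40, left associativity).
Local Notation "x ^&" := (ginv (dot S) x) (at level 1, format "x ^&").

(** The Galois-fixed part of L[(G, .)], with g acting on coefficients and through gamma_g on group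
    elements. The pair [p] is (g, x), and an intersection of kernels presents it as a subspace. *)
Definition invariant_ends : {vspace 'End(L)} :=
  (\bigcap_p lker (cf (gamma S p.1 p.2) - (gal_repr p.1 \o cf p.2)%VF))%VS.

Lemma invariant_endsP f :
  reflect (forall g x, cf (gamma S g x) f = g (cf x f)) (f \in invariant_ends).
Proof.
have E p : (f \in lker (cf (gamma S p.1 p.2) - (gal_repr p.1 \o cf p.2)%VF)) =
    (cf (gamma S p.1 p.2) f == p.1 (cf p.2 f)).
  by rewrite memv_ker add_lfunE opp_lfunE comp_lfunE subr_eq0.
apply: (iffP idP) => [fV g x|fV].
  apply/eqP; rewrite -(E (g, x)); apply: subvP fV.
  exact: (bigcapv_inf (g, x) isT (subvv _)).
by rewrite memvE; apply/subv_bigcapP => p _; rewrite -memvE E fV.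
Qed.

(** Invariance absorbs the twist by x of the crossed product into gamma, so that composition becomes
    multiplication in the group algebra of (G, .). *)
Lemma cf_comp_invariant f g z : f \in invariant_ends -> g \in invariant_ends ->
  cf z (f \o g)%VF = \sum_x cf x f * cf (x^& ** z) g.
Proof.
move=> _ /invariant_endsP gV; rewrite (cf_comp galL); apply: eq_bigr => x _.
by rewrite -gV gamma_quo.
Qed.

Lemma invariant_ends_closed : comp_closed invariant_ends.
Proof.
split=> [|f g fV gV].
  apply/invariant_endsP => g x; rewrite !cf_id rmorph_nat.
  congr (nat_of_bool _)%:R; rewrite -(gid_dot circS) -{1}(gamma1 S g).
  by rewrite (can_eq (gammaK S g)).
apply/invariant_endsP => k z; rewrite !cf_comp_invariant // rmorph_sum.
rewrite (reindex_inj (can_inj (gammaK S k))); apply: eq_bigr => x _ /=.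
rewrite rmorphM /= -!(invariant_endsP _ _) //.
by rewrite gammaD gammaV.
Qed.

Definition inv_alg : falgType K := comp_alg invariant_ends_closed.

Definition inv_val (h : inv_alg) : 'End(L) := vsval h.

Fact inv_val_is_linear : linear inv_val.
Proof. by move=> k f g; rewrite /inv_val linearP. Qed.
HB.instance Definition _ :=
  GRing.isLinear.Build K inv_alg 'End(L) *:%R inv_val inv_val_is_linear.

Definition ipt x : 'Hom(inv_alg, L) := (cf x \o linfun inv_val)%VF.

Lemma iptE x h : ipt x h = cf x (inv_val h).
Proof. by rewrite comp_lfunE lfunE. Qed.

Lemma inv_valE h a : inv_val h a = \sum_x ipt x h * x a.
Proof. by rewrite (cfK galL); apply: eq_bigr => x _; rewrite iptE. Qed.

Lemma ipt_gamma g x h : ipt (gamma S g x) h = g (ipt x h).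
Proof. by rewrite !iptE; apply: (invariant_endsP _ (subvsP h)). Qed.

Lemma iptM z h k : ipt z (h * k) = \sum_x ipt x h * ipt (x^& ** z) k.
Proof.
rewrite iptE /inv_val val_comp_mul cf_comp_invariant ?subvsP //.
by apply: eq_bigr => x _; rewrite !iptE.
Qed.

Lemma ipt1 x : ipt x 1 = (x == 1%g)%:R.
Proof. by rewrite iptE /inv_val val_comp_one cf_id. Qed.

Lemma ipt_surj v : equivariant (gamma S) v -> exists h, forall x, ipt x h = v x.
Proof.
move=> eqv; exists (vsproj _ (sum_gal [ffun x => v x]) : inv_alg) => x.
rewrite iptE /inv_val vsprojK ?cf_sum_gal ?ffunE //.
by apply/invariant_endsP => g y; rewrite !cf_sum_gal !ffunE.
Qed.

Lemma ipt_detects : detects ipt {:inv_alg} setT.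
Proof.
apply: (trace_detects (gamma_gal1 circS) (gamma_galM circS)) => [g x _|v eqv _].
  by rewrite inE.
by have [h hE] := ipt_surj eqv; exists h; rewrite ?memvf.
Qed.

Lemma ipt_separates : separates ipt.
Proof.
apply: (trace_separates (gamma_gal1 circS) (gamma_galM circS) galL ipt_gamma).
move=> h h0; apply: subvs_inj; rewrite linear0; apply: (cf_inj galL) => x.
by rewrite linear0 -[LHS]iptE.
Qed.

Local Notation evi x y := (ev ipt ipt x y).

Lemma evi_inj s t : (forall x y, evi x y s = evi x y t) -> s = t.
Proof.
apply: ev_inj ipt_separates _ => v v0; exact: separates_eq0 ipt_separates v0.
Qed.

(** Injectivity of each gamma_g makes the diagonal family [x = y] c_x(h) equivariant in the pair (x,
    y), so it descends to a tensor. *)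
Lemma exists_inv_comul : exists D : {linear inv_alg -> tens inv_alg inv_alg},
  forall x y h, evi x y (D h) = (x == y)%:R * ipt x h.
Proof.
have [D DE] : exists D : 'Hom(inv_alg, tens inv_alg inv_alg),
    forall p h, linfun (evi p.1 p.2) (D h) = ((p.1 == p.2)%:R *: ipt p.1)%R h.
  apply: lift_hom => h.
  have [] := @descent_tens _ _ _ _ (gamma_gal1 circS) (gamma_galM circS) galL
    _ _ ipt ipt (fun x y => (x == y)%:R * ipt x h)
    ipt_detects ipt_separates ipt_gamma ipt_detects ipt_separates ipt_gamma.
    move=> g x y; rewrite ipt_gamma rmorphM rmorph_nat.
    by rewrite (can_eq (gammaK S g)).
  move=> t tE; exists t => p; rewrite lfunE /= tE scale_lfunE.
  by rewrite -mulr_algl scaler_nat.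
exists D => x y h; have := DE (x, y) h; rewrite lfunE => ->.
by rewrite scale_lfunE -mulr_algl scaler_nat.
Qed.

Lemma exists_inv_counit : exists e : {linear inv_alg -> K^o},
  forall h, (e h : K)%:A = \sum_x ipt x h :> L.
Proof.
have linA : linear (fun k : K^o => (k : K)%:A : L).
  by move=> a k l; rewrite scalerDl scalerA.
pose inA : {linear K^o -> L} :=
  HB.pack (fun k : K^o => (k : K)%:A : L) (GRing.isLinear.Build K K^o L _ _ linA).
(* The inclusion of [K] in [L] serves as a one-member family of points on [K^o], so that [lift_hom]
   applies. *)
have [e eE] : exists e : 'Hom(inv_alg, K^o),
    forall (i : 'I_1) h, linfun inA (e h) = (\sum_x ipt x) h.
  apply: lift_hom => h; have [k kE] : exists k : K, \sum_x ipt x h = k%:A.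
    apply: (gal_fixed_scalar galL) => g; rewrite rmorph_sum.
    rewrite [RHS](reindex_inj (can_inj (gammaK S g))).
    by apply: eq_bigr => x _; rewrite ipt_gamma.
  by exists (k : K^o) => i; rewrite lfunE sum_lfunE kE.
by exists e => h; have := eE ord0 h; rewrite lfunE sum_lfunE.
Qed.

Lemma exists_inv_antipode : exists s : {linear inv_alg -> inv_alg},
  forall x h, ipt x (s h) = ipt x^& h.
Proof.
have [s sE] : exists s : 'Hom(inv_alg, inv_alg), forall x h,
    ipt x (s h) = ipt x^& h.
  apply: lift_hom => h; apply: ipt_surj => g x.
  by rewrite -gammaV ipt_gamma.
by exists s.
Qed.

Variables (D : {linear inv_alg -> tens inv_alg inv_alg})
  (e : {linear inv_alg -> K^o}) (s : {linear inv_alg -> inv_alg}).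
Hypothesis DE : forall x y h, evi x y (D h) = (x == y)%:R * ipt x h.
Hypothesis eE : forall h, (e h : K)%:A = \sum_x ipt x h :> L.
Hypothesis sE : forall x h, ipt x (s h) = ipt x^& h.

Lemma ipt_inj g h : (forall x, ipt x g = ipt x h) -> g = h.
Proof. exact/separates_inj/ipt_separates. Qed.

Lemma tens_lift_ipt x y h :
  tens_lift (fun u v => ipt x u * ipt y v) (D h) = (x == y)%:R * ipt x h.
Proof. exact: DE. Qed.

(** At a triple of points both sides take the common value c_x(h) if the three points agree, and 0
    otherwise. *)
Fact inv_comulA h :
  tens_lift (fun a b => tens_lift (fun a1 a2 => pure a1 (pure a2 b)) (D a)) (D h)
  = tens_lift (fun a b => pure a (D b)) (D h).
Proof.
pose d p : 'Hom(tens inv_alg inv_alg, L) := linfun (evi p.1 p.2).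
apply: (ev_inj (c := ipt) (d := d)) => [|t t0|x p]; first exact: ipt_separates.
  by apply: evi_inj => x y; rewrite linear0 -[RHS](t0 (x, y)) lfunE.
have evp u v w : ev ipt d x p (pure u (pure v w)) =
    ipt x u * (ipt p.1 v * ipt p.2 w).
  by rewrite ev_pure [d p _]lfunE /= ev_pure.
rewrite !linear_tens_lift /=.
under eq_tens_lift => u v do [rewrite linear_tens_lift /=;
  under eq_tens_lift => u1 u2 do rewrite evp mulrA;
  rewrite -tens_liftMr tens_lift_ipt -mulrA].
rewrite -tens_liftMl tens_lift_ipt.
under [RHS]eq_tens_lift => u v do rewrite ev_pure [d p _]lfunE /= DE mulrCA.
rewrite -tens_liftMl tens_lift_ipt.
by case: (eqVneq x p.1) => [->|_]; rewrite ?mul1r // !mul0r mulr0.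
Qed.

Fact inv_counitl h : tens_lift (fun a b => e a *: b) (D h) = h.
Proof.
apply: ipt_inj => y; rewrite linear_tens_lift /=.
under eq_tens_lift => u v do rewrite linearZ /= -mulr_algl eE mulr_suml.
rewrite tens_lift_suml; under eq_bigr do rewrite tens_lift_ipt.
by rewrite sum_delta.
Qed.

Fact inv_counitr h : tens_lift (fun a b => e b *: a) (D h) = h.
Proof.
apply: ipt_inj => y; rewrite linear_tens_lift /=.
under eq_tens_lift => u v do
  rewrite linearZ /= -mulr_algl eE mulrC mulr_sumr.
rewrite tens_lift_suml.
by under eq_bigr do rewrite tens_lift_ipt eq_sym; rewrite sum_delta.
Qed.

Fact inv_comul1 : D 1 = pure 1 1.
Proof.
apply: evi_inj => x y; rewrite DE ev_pure !ipt1.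
case: (eqVneq x 1%g) => [->|_]; last by rewrite mulr0 mul0r.
by rewrite mulr1 mul1r eq_sym.
Qed.

Fact inv_comulM h k : D (h * k) = tens_mul (D h) (D k).
Proof.
apply: evi_inj => x y; rewrite DE iptM mulr_sumr linear_tens_lift /=.
have E a b : evi x y (tens_lift (fun c d => pure (a * c) (b * d)) (D k)) =
    \sum_u \sum_w ((u^& ** x == w^& ** y)%:R * ipt (u^& ** x) k) *
      (ipt u a * ipt w b).
  rewrite linear_tens_lift /=.
  have F c d : evi x y (pure (a * c) (b * d)) = \sum_u \sum_w
      (ipt u a * ipt w b) * (ipt (u^& ** x) c * ipt (w^& ** y) d).
    rewrite ev_pure !iptM mulr_suml; apply: eq_bigr => u _.
    by rewrite mulr_sumr; apply: eq_bigr => w _; rewrite mulrACA.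
  rewrite (eq_tens_lift _ F) tens_lift_suml; apply: eq_bigr => u _.
  rewrite tens_lift_suml; apply: eq_bigr => w _.
  by rewrite -tens_liftMl tens_lift_ipt mulrC.
rewrite (eq_tens_lift _ E) tens_lift_suml; apply: eq_bigr => u _.
rewrite tens_lift_suml.
under eq_bigr do rewrite -tens_liftMl tens_lift_ipt mulrCA eq_sym.
(* Comultiplying h has forced u = w; cancelling u then turns the condition coming from k into x =
   y. *)
rewrite sum_delta (inj_eq (@gopI _ (dot S) u^&)).
by rewrite mulrA mulrAC -mulrA.
Qed.

Fact inv_counit1 : e 1 = 1.
Proof.
apply: (fmorph_inj (in_alg L)); rewrite /= eE scale1r.
under eq_bigr do rewrite ipt1 -[(_ == _)%:R]mulr1.
by rewrite (sum_delta (fun=> 1)).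
Qed.

Fact inv_counitM h k : e (h * k) = e h * e k.
Proof.
apply: (fmorph_inj (in_alg L)); rewrite rmorphM /= !eE mulr_suml.
under eq_bigr do rewrite iptM.
rewrite exchange_big; apply: eq_bigr => u _ /=.
rewrite mulr_sumr (reindex_inj (@gopI _ (dot S) u)); apply: eq_bigr => z _.
by rewrite gopK.
Qed.

Fact ipt_scalar (k : K) z : ipt z (k%:A : inv_alg) = (z == 1%g)%:R * k%:A.
Proof. by rewrite linearZ /= ipt1 mulr_algr. Qed.

Fact inv_antipodel h : tens_lift (fun a b => s a * b) (D h) = (e h : K)%:A.
Proof.
apply: ipt_inj => z; rewrite linear_tens_lift /= ipt_scalar eE mulr_sumr.
have E u v : ipt z (s u * v) = \sum_x ipt x u * ipt (x ** z) v.
  rewrite iptM (reindex_inj (inv_inj (@ginvK _ (dot S)))).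
  by apply: eq_bigr => x _; rewrite /= sE ginvK.
rewrite (eq_tens_lift _ E) tens_lift_suml; apply: eq_bigr => x _.
rewrite tens_lift_ipt -[x in x == _](gopg1 (dot S)).
by rewrite (inj_eq (@gopI _ (dot S) x)) (gid_dot circS) eq_sym.
Qed.

Fact inv_antipoder h : tens_lift (fun a b => a * s b) (D h) = (e h : K)%:A.
Proof.
apply: ipt_inj => z; rewrite linear_tens_lift /= ipt_scalar eE mulr_sumr.
have E u v : ipt z (u * s v) = \sum_x ipt x u * ipt (z^& ** x) v.
  by rewrite iptM; apply: eq_bigr => x _; rewrite sE ginvM ginvK.
rewrite (eq_tens_lift _ E) tens_lift_suml; apply: eq_bigr => x _.
rewrite tens_lift_ipt -[x in x == _](gop1g (dot S)).
rewrite (inj_eq (@gopIr _ (dot S) x)) (gid_dot circS) eq_sym.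
rewrite -[1%g in LHS](gid_dot circS) -[X in _ == X](ginv1 (dot S)).
by rewrite (inj_eq (inv_inj (@ginvK _ (dot S)))) (gid_dot circS).
Qed.

Definition inv_hopf : hopf_algebra K := HopfAlgebra inv_comulA inv_counitl
  inv_counitr inv_comul1 inv_comulM inv_counit1 inv_counitM inv_antipodel
  inv_antipoder.

Fact inv_act1 x : inv_val 1 x = x.
Proof. by rewrite /inv_val val_comp_one id_lfunE. Qed.

Fact inv_actM h k x : inv_val (h * k) x = inv_val h (inv_val k x).
Proof. by rewrite /inv_val val_comp_mul comp_lfunE. Qed.

Fact inv_act_one h : inv_val h 1 = (counit inv_hopf h : K)%:A.
Proof.
by rewrite inv_valE [RHS]eE; apply: eq_bigr => x _; rewrite rmorph1 mulr1.
Qed.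

Fact inv_act_mul h x y :
  inv_val h (x * y) = tens_lift (fun a b => inv_val a x * inv_val b y) (D h).
Proof.
have E u v : inv_val u x * inv_val v y =
    \sum_g \sum_k (g : G) x * (k : G) y * (ipt g u * ipt k v).
  rewrite !inv_valE mulr_suml; apply: eq_bigr => g _; rewrite mulr_sumr.
  by apply: eq_bigr => k _; rewrite mulrACA mulrC.
rewrite (eq_tens_lift _ E) tens_lift_suml inv_valE; apply: eq_bigr => g _.
rewrite tens_lift_suml.
under eq_bigr do rewrite -tens_liftMl tens_lift_ipt mulrCA eq_sym.
by rewrite sum_delta rmorphM mulrC.
Qed.

(** The arguments of [pt_separates] and [pt_detects] run backwards: separation gives injectivity,
    and solving for the coefficients of [f] gives surjectivity. *)
Fact inv_hg_bij : bijective (hg_map (H := inv_hopf) inv_val).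
Proof.
have cfE (t : tens L inv_alg) x : cf x (hg_map (H := inv_hopf) inv_val t) =
    \sum_j (\sum_i t i j *: (vbasis {:L})`_i) * ipt x (vbasis {:inv_alg})`_j.
  rewrite (cf_hg_map galL) /tens_lift exchange_big; apply: eq_bigr => j _.
  rewrite mulr_suml; apply: eq_bigr => i _.
  by rewrite -scalerAl -[cf _ _]iptE.
have ker0 : lker (linfun (hg_map (H := inv_hopf) inv_val)) == 0%VS.
  apply/lker0P => t u; rewrite !lfunE => tu.
  have {}tu : hg_map (H := inv_hopf) inv_val t =
      hg_map (H := inv_hopf) inv_val u.
    exact: tu.
  apply/eqP; rewrite -subr_eq0; apply/eqP/matrixP => i j; rewrite [RHS]mxE.
  move: i; apply: vbasis_eq0; move: j; apply: ipt_separates => x.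
  rewrite -cfE; transitivity (cf x (hg_map (H := inv_hopf) inv_val t -
    hg_map (H := inv_hopf) inv_val u)); last by rewrite tu subrr linear0.
  by congr (cf x _); apply: (linearB (tens_lift _)).
have im f : f \in limg (linfun (hg_map (H := inv_hopf) inv_val)).
  have [a aE] := detects_solve (fun x => cf x f) ipt_detects.
  apply/memv_imgP; exists (\matrix_(i, j) coord (vbasis {:L}) i (a j));
    rewrite ?memvf // lfunE /=.
  apply: (cf_inj galL) => x; rewrite cfE -aE; apply: eq_bigr => j _.
  congr (_ * _); rewrite [LHS](coord_vbasis (memvf _)); apply: eq_bigr => i _.
  by rewrite mxE.
exists (fun f => (linfun (hg_map (H := inv_hopf) inv_val))^-1%VF f) => t.
  by rewrite -[hg_map _ _]lfunE lker0_lfunK.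
by rewrite -[hg_map _ _]lfunE limg_lfunVK.
Qed.

Definition inv_hopf_galois : hopf_galois L :=
  @HopfGalois K L inv_hopf inv_val inv_act1 inv_actM inv_act_one inv_act_mul
    inv_hg_bij.

Lemma inv_hopf_galois_compatible : compatible S inv_hopf_galois.
Proof.
by split=> // g x h; rewrite !ptE -[LHS]iptE -[cf _ _]iptE ipt_gamma.
Qed.

End StructureOfBrace.

Lemma exists_compatible_structure (K : fieldType) (L : splittingFieldType K)
    (galL : galois 1%VS {:L}) (S : skew_brace (gal_of {:L})) :
  gop (circ S) =2 @gal_comp K L -> exists T, compatible S T.
Proof.
move=> circS; have [D DE] := exists_inv_comul galL circS.
have [e eE] := exists_inv_counit galL circS.
have [s sE] := exists_inv_antipode galL circS.
by exists (inv_hopf_galois DE eE sE); apply: inv_hopf_galois_compatible.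
Qed.

(** * The correspondence *)

Lemma inj_surj_bijective (X Y : Type) (f : X -> Y) :
  injective f -> (forall y, exists x, f x = y) -> bijective f.
Proof.
move=> injf surjf.
pose g y := proj1_sig (constructive_indefinite_description _ (surjf y)).
have gK : cancel g f.
  by move=> y; exact: proj2_sig (constructive_indefinite_description _ (surjf y)).
by exists g => // x; apply: injf; rewrite gK.
Qed.

Lemma exist_eq (X : Type) (P : X -> Prop) (x y : {z | P z}) :
  proj1_sig x = proj1_sig y -> x = y.
Proof.
case: x y => [x Px] [y Py] /= xy; case: y / xy Py => Py.
by rewrite (proof_irrelevance _ Px Py).
Qed.

Theorem theorem4p1 (K : fieldType) (L : splittingFieldType K)
    (A B : {group gal_of (fullv : {vspace L})})
    (galL : galois 1%VS (fullv : {vspace L}))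
    (semidirectAB : (A ><| B)%g = ('Gal(fullv / 1%VS))%g) :
  exists Phi : semidirect_brace_op A B -> hopf_galois_class A B, bijective Phi.
Proof.
have exT (o : semidirect_brace_op A B) : exists T S, compatible S T /\
    [/\ gop (dot S) =2 proj1_sig o & internal_semidirect S A B].
  have [S [dotS circS sdS]] := proj2_sig o.
  have [T compST] := exists_compatible_structure galL circS.
  by exists T, S.
(* Structures compatible with the same operation are isomorphic by [dot_hg_iso], so the class does
   not depend on this choice. *)
pose Tof o := proj1_sig (constructive_indefinite_description _ (exT o)).
have TofP o : exists S, compatible S (Tof o) /\
    [/\ gop (dot S) =2 proj1_sig o & internal_semidirect S A B].
  exact: proj2_sig (constructive_indefinite_description _ (exT o)).
have realT o : exists T, realises_semidirect A B T /\ hg_iso (Tof o) = hg_iso T.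
  have [S [compST [_ sdS]]] := TofP o.
  by exists (Tof o); split=> //; apply/(realises_semidirectP galL compST).
exists (fun o => exist _ (hg_iso (Tof o)) (realT o)).
apply: inj_surj_bijective;
  [move=> o o' /(congr1 (@proj1_sig _ _)) /= eqT|case=> C [T [rT CT]]].
  have [S [compST [dotS _]]] := TofP o.
  have [S' [compST' [dotS' _]]] := TofP o'.
  apply: exist_eq; apply: functional_extensionality => x.
  apply: functional_extensionality => y; rewrite -dotS -dotS'.
  apply: (hg_iso_dot galL compST compST').
  (* Equality of classes reduces the claim to reflexivity of [hg_iso], which follows from equality
     of the operations. *)
  by rewrite eqT; apply: (dot_hg_iso galL compST' compST').
have [S compST] := exists_compatible_brace galL T.
have opS : is_semidirect_brace_op A B (gop (dot S)).
  exists S; split=> //; first exact: compST.1.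
  exact/(realises_semidirectP galL compST).
pose o : semidirect_brace_op A B := exist _ _ opS.
exists o; apply: exist_eq; rewrite /= CT.
have [S' [compST' [dotS' _]]] := TofP o.
(* Both classes are compared at [U] through its own skew brace: membership in either one means that
   its operation agrees with the operation common to [S] and [S']. *)
apply: functional_extensionality => U; apply: propositional_extensionality.
have [S'' compSU] := exists_compatible_brace galL U.
split=> [/(hg_iso_dot galL compST' compSU)|/(hg_iso_dot galL compST compSU)] eqd.
  by apply: (dot_hg_iso galL compST compSU) => x y; rewrite -eqd dotS'.
by apply: (dot_hg_iso galL compST' compSU) => x y; rewrite -eqd dotS'.
Qed.
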